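(* The mirror of every complex reflection in $\Gamma_3$ is in the $\Gamma_3$-orbit of the mirror polar to exactly one of the vectors $w_1=(0,1,0)$, $w_2=(1,0,1)$. The subgroup of $\Gamma_3$ fixing pointwise the mirror polar to $w_1$, $w_2$ is cyclic of order $6$, $2$ respectively.
   Context: On $\mathbb{C}^3$ let $\langle v,w\rangle=w^*Jv$ with $J=\begin{pmatrix}0&0&1\\0&1&0\\1&0&0\end{pmatrix}$, $U(J)=\{A\in GL_3(\mathbb{C}):A^*JA=J\}$, and let $\Gamma_d=PU(J,\mathcal{O}_d)$ be the image in $PU(J)$ of $U(J)\cap GL_3(\mathcal{O}_d)$, with $\mathcal{O}_d$ the ring of integers of $\mathbb{Q}(i\sqrt d)$ (so $\mathcal{O}_3=\mathbb{Z}[e^{2\pi i/3}]$). It acts on the complex hyperbolic plane $\mathbf{H}^2_{\mathbb{C}}=\{\mathbb{C}v:\langle v,v\rangle<0\}$. For $w$ with $\langle w,w\rangle>0$, the mirror polar to $w$ is $\{\mathbb{C}v\in\mathbf{H}^2_{\mathbb{C}}:\langle v,w\rangle=0\}$; a complex reflection is a nontrivial finite-order element fixing pointwise such a mirror. *)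

(* Defs.v *)
From HB Require Import structures.
From mathcomp Require Import all_boot all_order all_algebra.
From mathcomp Require Import complex.
From mathcomp Require Import boolp classical_sets cardinality reals.

Set Implicit Arguments.
Unset Strict Implicit.
Unset Printing Implicit Defensive.

Import Order.TTheory GRing.Theory Num.Theory.

Local Open Scope ring_scope.
Local Open Scope classical_set_scope.
Local Open Scope quotient_scope.

Section HermitianForm.
Variable R : realType.
Local Notation C := R[i].

Definition adjmx m n (A : 'M[C]_(m, n)) : 'M[C]_(n, m) :=
  map_mx Num.conj A^T.

Definition J : 'M[C]_3 := \matrix_(i, j) (i + j == 2)%N%:R.

Definition herm (v w : 'cV[C]_3) : C := (adjmx w *m J *m v) 0 0.

Definition vec3 (a b c : C) : 'cV[C]_3 := \col_(i < 3) [:: a; b; c]`_i.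

Lemma adjmxM m n p (A : 'M[C]_(m, n)) (B : 'M[C]_(n, p)) :
  adjmx (A *m B) = adjmx B *m adjmx A.
Proof. by rewrite /adjmx trmx_mul map_mxM. Qed.

Lemma adjmx1 n : adjmx (1%:M : 'M[C]_n) = 1%:M.
Proof. by rewrite /adjmx trmx1 map_mx1. Qed.

End HermitianForm.

Section UnitaryGroup.
Variable R : realType.
Local Notation C := R[i].

Definition isUJ : pred 'M[C]_3 :=
  fun A => (A \in unitmx) && (adjmx A *m J R *m A == J R).

Record UJ := MkUJ { UJval :> 'M[C]_3; UJvalP : isUJ UJval }.

HB.instance Definition _ := [isSub for UJval].
HB.instance Definition _ := [Choice of UJ by <:].

Fact isUJ1 : isUJ 1%:M.
Proof. by rewrite /isUJ unitmx1 adjmx1 mul1mx mulmx1 /=. Qed.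

Fact isUJM (A B : UJ) : isUJ (UJval A *m UJval B).
Proof.
case: A B => [A /andP[uA /eqP hA]] [B /andP[uB /eqP hB]] /=.
rewrite /isUJ unitmx_mul uA uB adjmxM -!mulmxA (mulmxA (J R)) (mulmxA _ _ B).
by rewrite (mulmxA (adjmx A)) hA mulmxA hB /=.
Qed.

Fact isUJV (A : UJ) : isUJ (invmx (UJval A)).
Proof.
case: A => [A /andP[uA /eqP hA]] /=.
rewrite /isUJ unitmx_inv uA -{1}hA -!mulmxA mulmxV // mulmx1 mulmxA -adjmxM.
by rewrite mulmxV // adjmx1 mul1mx /=.
Qed.

Definition UJ_one := MkUJ isUJ1.
Definition UJ_mul (A B : UJ) := MkUJ (isUJM A B).
Definition UJ_inv (A : UJ) := MkUJ (isUJV A).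

Fact UJ_mulA : associative UJ_mul.
Proof. by move=> A B D; apply: val_inj; rewrite /= mulmxA. Qed.
Fact UJ_mul1 : left_id UJ_one UJ_mul.
Proof. by move=> A; apply: val_inj; rewrite /= mul1mx. Qed.
Fact UJ_1mul : right_id UJ_one UJ_mul.
Proof. by move=> A; apply: val_inj; rewrite /= mulmx1. Qed.
Fact UJ_mulV : left_inverse UJ_one UJ_inv UJ_mul.
Proof.
by move=> A; apply: val_inj; case/andP: (UJvalP A) => uA _; rewrite /= mulVmx.
Qed.
Fact UJ_Vmul : right_inverse UJ_one UJ_inv UJ_mul.
Proof.
by move=> A; apply: val_inj; case/andP: (UJvalP A) => uA _; rewrite /= mulmxV.
Qed.

HB.instance Definition _ :=
  isGroup.Build UJ UJ_mulA UJ_mul1 UJ_1mul UJ_mulV UJ_Vmul.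

End UnitaryGroup.

Section ProjectiveUnitaryGroup.
Variable R : realType.
Local Notation C := R[i].
Local Notation UJ := (UJ R).

(* PU(J) is the quotient of U(J) by its scalar matrices; the scalar [c] below is
   automatically nonzero (see [proj_eq_neq0]). *)
Definition proj_eq (A B : UJ) : bool :=
  `[< exists c : C, UJval A = c *: UJval B >].

Fact UJ_neq0 (A : UJ) : UJval A != 0.
Proof.
case/andP: (UJvalP A) => uA _; apply/eqP => A0.
by move: uA; rewrite A0 unitmxE det0 unitr0.
Qed.

Fact proj_eq_neq0 (A B : UJ) (c : C) : UJval A = c *: UJval B -> c != 0.
Proof.
by move=> e; apply/eqP => c0; case/eqP: (UJ_neq0 A); rewrite e c0 scale0r.
Qed.

Fact proj_eq_refl : reflexive proj_eq.
Proof. by move=> A; apply/asboolP; exists 1; rewrite scale1r. Qed.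
Fact proj_eq_sym : symmetric proj_eq.
Proof.
suff h A B : proj_eq A B -> proj_eq B A by move=> A B; apply/idP/idP; exact: h.
move=> /asboolP[c e]; apply/asboolP; exists c^-1.
by rewrite e scalerA mulVf ?scale1r // (proj_eq_neq0 e).
Qed.
Fact proj_eq_trans : transitive proj_eq.
Proof.
move=> B A D /asboolP[c e] /asboolP[k f]; apply/asboolP; exists (c * k).
by rewrite e f scalerA.
Qed.

Canonical proj_eq_equiv :=
  EquivRel proj_eq proj_eq_refl proj_eq_sym proj_eq_trans.

Definition PU := {eq_quot proj_eq}%qT.
HB.instance Definition _ : EqQuotient _ proj_eq PU := EqQuotient.on PU.
HB.instance Definition _ := Choice.on PU.

Fact PU_eqP (A B : UJ) :
  (\pi_PU A = \pi_PU B) <-> exists c : C, UJval A = c *: UJval B.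
Proof.
split=> [/eqP|h]; first by rewrite eqmodE => /asboolP.
by apply/eqP; rewrite eqmodE; apply/asboolP.
Qed.

Definition PU_one : PU := \pi_PU (1%g : UJ).
Definition PU_mul := lift_op2 PU (fun A B : UJ => (A * B)%g).
Definition PU_inv := lift_op1 PU (fun A : UJ => (A^-1)%g).

Fact pi_PU_one : \pi_PU (1%g : UJ) = PU_one.
Proof. by []. Qed.

Fact pi_PU_mul : {morph \pi_PU : A B / (A * B)%g >-> PU_mul A B}.
Proof.
move=> A B; unlock PU_mul; apply/PU_eqP.
have [c ec] : exists c : C, UJval (repr (\pi_PU A)) = c *: UJval A.
  by apply/PU_eqP; rewrite reprK.
have [d ed] : exists c : C, UJval (repr (\pi_PU B)) = c *: UJval B.
  by apply/PU_eqP; rewrite reprK.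
have c0 := proj_eq_neq0 ec; have d0 := proj_eq_neq0 ed.
exists (c * d)^-1.
rewrite /= ec ed -scalemxAl -scalemxAr !scalerA -?mulrA mulVf ?scale1r //.
by rewrite mulf_neq0.
Qed.

Fact pi_PU_inv : {morph \pi_PU : A / (A^-1)%g >-> PU_inv A}.
Proof.
move=> A; unlock PU_inv; apply/PU_eqP.
have [c ec] : exists c : C, UJval (repr (\pi_PU A)) = c *: UJval A.
  by apply/PU_eqP; rewrite reprK.
have c0 := proj_eq_neq0 ec.
exists c; rewrite /= ec.
case/andP: (UJvalP A) => uA _.
by rewrite invmxZ ?scalerA ?mulfV ?scale1r // unitmxZ ?unitfE.
Qed.

Canonical pi_PU_mul_morph := PiMorph2 pi_PU_mul.
Canonical pi_PU_inv_morph := PiMorph1 pi_PU_inv.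

Fact PU_mulA : associative PU_mul.
Proof.
by elim/quotW=> A; elim/quotW=> B; elim/quotW=> D; rewrite !piE mulgA.
Qed.
Fact PU_1mul : left_id PU_one PU_mul.
Proof. by elim/quotW=> A; rewrite /PU_one !piE mul1g. Qed.
Fact PU_mul1 : right_id PU_one PU_mul.
Proof. by elim/quotW=> A; rewrite /PU_one !piE mulg1. Qed.
Fact PU_Vmul : left_inverse PU_one PU_inv PU_mul.
Proof. by elim/quotW=> A; rewrite /PU_one !piE mulVg. Qed.
Fact PU_mulV : right_inverse PU_one PU_inv PU_mul.
Proof. by elim/quotW=> A; rewrite /PU_one !piE mulgV. Qed.

HB.instance Definition _ :=
  isGroup.Build PU PU_mulA PU_1mul PU_mul1 PU_Vmul PU_mulV.

End ProjectiveUnitaryGroup.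

Section IntegralSubgroup.
Variables (R : realType) (d : nat).
Local Notation C := R[i].

Definition quadratic_field : set C :=
  [set z | exists a b : rat, z = ratr a + ratr b * ('i * sqrtC d%:R)].

Definition ring_of_integers : set C :=
  [set z | quadratic_field z /\ integralOver intr z].

Definition mx_integral (A : 'M[C]_3) : Prop :=
  forall i j, ring_of_integers (A i j).

(* U(J) meets GL_3(O_d): both A and its inverse have entries in O_d. *)
Definition UJ_integral : set (UJ R) :=
  [set A | mx_integral (UJval A) /\ mx_integral (invmx (UJval A))].

Definition Gamma : set (PU R) := (fun A => \pi_(PU R) A) @` UJ_integral.

End IntegralSubgroup.
Arguments Gamma : clear implicits.

Section HyperbolicPlane.
Variable R : realType.
Local Notation C := R[i].
Local Notation line := {vspace 'cV[C]_3}.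

(* Points of the projective plane are lines of C^3 through 0. *)
Definition H2C : set line :=
  [set L | exists v : 'cV[C]_3, herm v v < 0 /\ L = <[v]>%VS].

Definition UJ_act (A : UJ R) (L : line) : line :=
  (linfun (mulmx (UJval A)) @: L)%VS.

(* Independent of the representative: see [PU_actE]. *)
Definition PU_act (g : PU R) (L : line) : line := UJ_act (repr g) L.

Lemma UJ_act_line (A : UJ R) (v : 'cV[C]_3) :
  UJ_act A <[v]>%VS = <[UJval A *m v]>%VS.
Proof. by rewrite /UJ_act limg_line lfunE. Qed.

Lemma PU_actE (A : UJ R) (L : line) : PU_act (\pi_(PU R) A) L = UJ_act A L.
Proof.
have [c ec] : exists c : C, UJval (repr (\pi_(PU R) A)) = c *: UJval A.
  by apply/PU_eqP; rewrite reprK.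
have c0 := proj_eq_neq0 ec.
rewrite /PU_act /UJ_act; apply/vspaceP => y; apply/memv_imgP/memv_imgP.
  case=> x xL ->; exists (c *: x); first exact: memvZ.
  by rewrite !lfunE /= ec -scalemxAl -scalemxAr.
case=> x xL ->; exists (c^-1 *: x); first exact: memvZ.
by rewrite !lfunE /= ec -scalemxAl -scalemxAr scalerA mulfV ?scale1r.
Qed.

Lemma PU_act1 (L : line) : PU_act 1%g L = L.
Proof.
have -> : (1%g : PU R) = \pi_(PU R) (1%g : UJ R) by rewrite pi_PU_one.
rewrite PU_actE; apply/vspaceP => y; apply/memv_imgP/idP.
  by case=> x xL ->; rewrite lfunE /= mul1mx.
by move=> yL; exists y; rewrite // lfunE /= mul1mx.
Qed.

Lemma PU_actM (g h : PU R) (L : line) :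
  PU_act (g * h)%g L = PU_act g (PU_act h L).
Proof.
elim/quotW: g => A; elim/quotW: h => B.
have -> : (\pi_(PU R) A * \pi_(PU R) B)%g = \pi_(PU R) (A * B)%g.
  by rewrite pi_PU_mul.
rewrite !PU_actE /UJ_act -limg_comp; congr (_ @: _)%VS.
by apply/lfunP => x; rewrite comp_lfunE !lfunE /= mulmxA.
Qed.

(* The condition [0 < herm w w] is not built in; it is required where [w] is
   quantified over, in [complex_reflection_in]. *)
Definition mirror (w : 'cV[C]_3) : set line :=
  H2C `&` [set L : line | forall v : 'cV[C]_3, v \in L -> herm v w = 0].

Definition fixes_pointwise (g : PU R) (M : set line) : Prop :=
  forall L, M L -> PU_act g L = L.

Definition finite_order (g : PU R) : Prop :=
  exists n : nat, (0 < n)%N /\ (g ^+ n)%g = 1%g.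

Definition complex_reflection_in (g : PU R) (w : 'cV[C]_3) : Prop :=
  [/\ g <> 1%g, finite_order g, 0 < herm w w & fixes_pointwise g (mirror w)].

Definition in_PU_orbit (G : set (PU R)) (M N : set line) : Prop :=
  exists g, G g /\ M = PU_act g @` N.

Definition pointwise_stabilizer (G : set (PU R)) (M : set line) : set (PU R) :=
  [set g | G g /\ fixes_pointwise g M].

(* [PU R] is an infinite group, so the finite-group notions do not apply. *)
Definition cyclic_of_order (S : set (PU R)) (n : nat) : Prop :=
  (exists g, S = [set h | exists k : nat, h = (g ^+ k)%g \/ h = (g ^- k)%g])
  /\ (S #= `I_n)%card.

Definition w1 : 'cV[C]_3 := vec3 0 1 0.
Definition w2 : 'cV[C]_3 := vec3 1 0 1.

End HyperbolicPlane.

(* Main.v *)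
Require Import Defs.
From HB Require Import structures.
From mathcomp Require Import all_boot all_order all_algebra.
From mathcomp Require Import algC algnum complex.
From mathcomp Require Import boolp classical_sets cardinality reals.
From mathcomp Require Import ring lra zify.

(* If [A] in U(J, O_3) fixes pointwise the mirror polar to [w], then it acts on the
   orthogonal of [w] by a scalar [mu], and [A x = mu x + k <x, w> w]. As [mu] is a
   double root of the characteristic polynomial, it lies in Q(omega); being integral
   it is an Eisenstein integer. Eisenstein integers being Euclidean, [w] can be taken
   primitive, and then integrality of [A - mu] forces [k] to be integral; since
   [k <w, w>] is the difference of two numbers of modulus one, [<w, w>] is 1 or 2.
   Heisenberg translations followed by the inversion [J] decrease the last coordinate
   of a polar vector of norm 1 or 2, down to a unit multiple of [w1] or [w2].
   The two orbits differ because 2 is not the norm of an Eisenstein integer. *)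

Set Implicit Arguments.
Unset Strict Implicit.
Unset Printing Implicit Defensive.

Import Order.TTheory GRing.Theory Num.Theory.
Local Open Scope ring_scope.

(** * The Eisenstein integers *)

Section Eisenstein.
Variable R : realType.
Local Notation C := R[i].
Implicit Types (z u v : C).

Definition omega : C := ((- 2^-1) +i* (2^-1 * Num.sqrt 3))%C.

Definition eis z := exists x y : int, z = x%:~R + y%:~R * omega.

(** Squared modulus, valued in [R] rather than [C] so that [lra] and [nra] apply. *)
Definition nsq z : R := complex.Re z ^+ 2 + complex.Im z ^+ 2.

Lemma conjE (a b : R) : Num.conj (a +i* b)%C = (a -i* b)%C.
Proof. by []. Qed.

Lemma sqr_sqrt3 : Num.sqrt 3 ^+ 2 = 3 :> R.
Proof. by rewrite sqr_sqrtr. Qed.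

Lemma sqrtC3E : 'i * sqrtC 3 = (0 +i* Num.sqrt 3)%C :> C.
Proof.
rewrite -complexiE.
have -> : sqrtC 3 = (Num.sqrt 3)%:C%C :> C.
  rewrite -[RHS]sqrCK ?ler0c ?sqrtr_ge0 //.
  by rewrite -rmorphXn /= sqr_sqrt3 rmorph_nat.
by apply/eqP; rewrite eq_complex /=; apply/andP; split; apply/eqP; ring.
Qed.

Lemma omega_sqr : omega ^+ 2 = - 1 - omega.
Proof.
have h := sqr_sqrt3; rewrite expr2.
by apply/eqP; rewrite eq_complex /=; apply/andP; split; apply/eqP; nra.
Qed.

Lemma conj_omega : Num.conj omega = - 1 - omega.
Proof.
by apply/eqP; rewrite eq_complex /=; apply/andP; split; apply/eqP; lra.
Qed.

Lemma mul_conjE z : z * Num.conj z = (nsq z)%:C%C.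
Proof.
case: z => a b; rewrite conjE; apply/eqP; rewrite eq_complex /nsq /=.
by apply/andP; split; apply/eqP; ring.
Qed.

Lemma nsqM u v : nsq (u * v) = nsq u * nsq v.
Proof. by case: u v => [a b] [c d]; rewrite /nsq /=; ring. Qed.

Lemma nsqJ z : nsq (Num.conj z) = nsq z.
Proof. by case: z => [a b]; rewrite conjE /nsq /= sqrrN. Qed.

Lemma nsq_ge0 z : 0 <= nsq z.
Proof. by rewrite addr_ge0 ?sqr_ge0. Qed.

Lemma nsq_eq0 z : (nsq z == 0) = (z == 0).
Proof.
by case: z => a b; rewrite /nsq paddr_eq0 ?sqr_ge0 // !sqrf_eq0 eq_complex.
Qed.

Lemma intrC (n : int) : n%:~R = (n%:~R : R)%:C%C :> C.
Proof. by rewrite rmorph_int. Qed.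

Lemma nsq_real_omega (x y : R) :
  nsq (x%:C%C + y%:C%C * omega) = x ^+ 2 - x * y + y ^+ 2.
Proof.
rewrite /nsq /=.
transitivity ((x - y / 2) ^+ 2 + y ^+ 2 / 4 * Num.sqrt 3 ^+ 2 : R).
  by field.
by rewrite sqr_sqrt3; field.
Qed.

Lemma nsq_intr (x y : int) :
  nsq (x%:~R + y%:~R * omega) = (x ^+ 2 - x * y + y ^+ 2)%:~R.
Proof.
by rewrite !intrC nsq_real_omega !(rmorphD, rmorphN, rmorphM, rmorphXn).
Qed.

Lemma eis_int (n : int) : eis n%:~R.
Proof. by exists n, 0; rewrite mul0r addr0. Qed.

Lemma eis0 : eis 0. Proof. exact: (eis_int 0). Qed.
Lemma eis1 : eis 1. Proof. exact: (eis_int 1). Qed.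

Lemma eis_omega : eis omega.
Proof. by exists 0, 1; rewrite mul1r add0r. Qed.

Lemma eisD u v : eis u -> eis v -> eis (u + v).
Proof.
by move=> [a [b ->]] [c [d ->]]; exists (a + c), (b + d); ring.
Qed.

Lemma eisN u : eis u -> eis (- u).
Proof. by move=> [a [b ->]]; exists (- a), (- b); ring. Qed.

Lemma eisB u v : eis u -> eis v -> eis (u - v).
Proof. by move=> hu hv; apply/eisD/eisN. Qed.

Lemma eisM u v : eis u -> eis v -> eis (u * v).
Proof.
move=> [a [b ->]] [c [d ->]].
exists (a * c - b * d), (a * d + b * c - b * d).
have h := omega_sqr; ring: h.
Qed.

Lemma eisJ u : eis u -> eis (Num.conj u).
Proof.
move=> [a [b ->]]; exists (a - b), (- b).
rewrite rmorphD rmorphM !rmorph_int /= conj_omega; ring.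
Qed.

Lemma eis_conj u : eis (Num.conj u) <-> eis u.
Proof. by split=> /eisJ //; rewrite conjCK. Qed.

Lemma nsq_nat u : eis u -> exists n : nat, nsq u = n%:R.
Proof.
move=> [x [y ->]]; rewrite nsq_intr.
exists `|(x ^+ 2 - x * y + y ^+ 2)%R|%N; rewrite natr_absz ger0_norm //; nia.
Qed.

(** Norm 2 would force [|x|, |y| <= 1], where the norm form only takes the values 0, 1 and 3. *)
Lemma nsq_neq2 u : eis u -> nsq u <> 2.
Proof.
move=> [x [y ->]]; rewrite nsq_intr => h.
have {h}: (x ^+ 2 - x * y + y ^+ 2)%:~R = 2%:~R :> R by [].
move/eqP; rewrite eqr_int => /eqP h.
have [hx hy]: `|x| <= 1 /\ `|y| <= 1 by split; nia.
have: x = -1 \/ x = 0 \/ x = 1 by lia.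
have: y = -1 \/ y = 0 \/ y = 1 by lia.
by move: h => /[swap] -[|[]] -> /[swap] -[|[]] ->.
Qed.

(** Rounding the coordinates in the basis [1, omega] leaves errors of at most 1/2, on which
    [e ^+ 2 - e * f + f ^+ 2] is at most 3/4. *)
Lemma eis_round z : exists2 q, eis q & nsq (z - q) < 1.
Proof.
set s : R := Num.sqrt 3; have s0 : s != 0 by rewrite sqrtr_eq0 -ltNge.
pose b : R := complex.Im z * 2 / s; pose a : R := complex.Re z + b / 2.
have -> : z = a%:C%C + b%:C%C * omega.
  rewrite /a /b /omega -/s; case: z {a b} => a b; apply/eqP; rewrite eq_complex /=.
  by apply/andP; split; apply/eqP; field.
pose x := Num.floor (a + 2^-1); pose y := Num.floor (b + 2^-1).
exists (x%:~R + y%:~R * omega); first by exists x, y.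
have -> : a%:C%C + b%:C%C * omega - (x%:~R + y%:~R * omega)
  = (a - x%:~R)%:C%C + (b - y%:~R)%:C%C * omega.
  by rewrite !intrC !rmorphB /=; ring.
rewrite nsq_real_omega.
have := floor_itv (a + 2^-1); have := floor_itv (b + 2^-1).
rewrite -/x -/y !intrD => /andP[y1 y2] /andP[x1 x2].
set e := a - _; set f := b - _.
have [e1 e2] : - 2^-1 <= e /\ e <= 2^-1 by rewrite /e; split; lra.
have [f1 f2] : - 2^-1 <= f /\ f <= 2^-1 by rewrite /f; split; lra.
nra.
Qed.


(** * Integral closure of Z in Q(omega) *)

Lemma integral_ratr a :
  integralOver (intr : int -> C) (ratr a) -> exists n : int, a = n%:~R.
Proof.
case=> p monp.
have -> : map_poly (intr : int -> C) p = map_poly ratr (map_poly intr p : {poly rat}).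
  by rewrite -map_poly_comp; apply: eq_map_poly => n /=; rewrite ratr_int.
rewrite fmorph_root => pa.
(* The same monic integer polynomial is read in [algC], where rational algebraic integers are
   integers. *)
suff : (ratr a : algC) \is a Num.int by rewrite Cint_rat => /intrP.
apply: Cint_rat_Aint; first exact: Crat_rat.
apply: (@root_monic_Aint (map_poly intr p)).
- have -> : map_poly (intr : int -> algC) p = map_poly ratr (map_poly intr p : {poly rat}).
    by rewrite -map_poly_comp; apply: eq_map_poly => n /=; rewrite ratr_int.
  by rewrite fmorph_root.
- exact: monic_map.
- by apply/polyOverP => i; rewrite coef_map /= intr_int.
Qed.

Lemma integral_conj z :
  integralOver (intr : int -> C) z -> integralOver (intr : int -> C) (Num.conj z).
Proof.
case=> p monp pz; exists p => //.
have -> : map_poly (intr : int -> C) p = map_poly Num.conj (map_poly intr p).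
  by rewrite -map_poly_comp; apply: eq_map_poly => n /=; rewrite rmorph_int.
by rewrite fmorph_root.
Qed.

(** The square of the denominator is coprime to that of the numerator, so it divides 3 and equals
    1. *)
Lemma sqr3_rat_int (q : rat) (n : int) :
  3 * q ^+ 2 = n%:~R -> exists m : int, q = m%:~R.
Proof.
move=> h.
have dq0 : (denq q)%:~R != 0 :> rat by rewrite intr_eq0 denq_neq0.
have e : 3 * numq q ^+ 2 = n * denq q ^+ 2.
  apply/eqP; rewrite -(eqr_int rat); apply/eqP.
  rewrite !rmorphM /= -h -{3}(divq_num_den q); field.
  exact: dq0.
have cop : coprimez (denq q ^+ 2) (numq q ^+ 2).
  by rewrite coprimezXl ?coprimezXr // coprimez_sym; exact: coprime_num_den.
have : (denq q ^+ 2 %| 3)%Z.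
  by rewrite -(Gauss_dvdzl _ cop) e dvdz_mull.
move/dvdzP=> [k hk].
have d1 : denq q = 1.
  have := denq_gt0 q; move: (denq q) hk => d hk d0.
  have k0 : 0 < k by nia.
  have [d2|] := ltP 1 d; last by lia.
  have : 2 * 2 <= d * d by apply: ler_pM; lia.
  move: hk; rewrite expr2; nia.
by exists (numq q); rewrite -{1}(divq_num_den q) d1 divr1.
Qed.

Lemma sqrt3_omega : 'i * sqrtC 3 = 1 + 2 * omega.
Proof.
rewrite sqrtC3E /omega; apply/eqP; rewrite eq_complex /=.
by apply/andP; split; apply/eqP; field.
Qed.

Local Notation integralC := (integralOver (intr : int -> C)).

Lemma integralC_int (n : int) : integralC n%:~R.
Proof. exact: (@integral_id int C intr). Qed.

Lemma integralC_add u v : integralC u -> integralC v -> integralC (u + v).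
Proof. exact: (@integral_add int C intr). Qed.

Lemma integralC_mul u v : integralC u -> integralC v -> integralC (u * v).
Proof. exact: (@integral_mul int C intr). Qed.

(** An integral [a + b * sqrt(-3)] has its trace [2 * a] and norm [a ^+ 2 + 3 * b ^+ 2] rational and
    integral, hence in Z; then [2 * b] is in Z too, and parity concludes. *)
Lemma ring_of_integers_eis z : ring_of_integers 3 z <-> eis z.
Proof.
rewrite /ring_of_integers /quadratic_field /= sqrt3_omega; split; last first.
  move=> [x [y ->]]; split.
    exists (x%:~R - y%:~R / 2), (y%:~R / 2).
    rewrite !(rmorphB, rmorphM, fmorphV) /= !ratr_int ratr_nat; by field.
  have iw : integralOver (intr : int -> C) omega.
    exists ('X^2 + 'X + 1).
      by rewrite -addrA monicE lead_coefDl ?lead_coefXn // size_polyXn size_XaddC.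
    apply/rootP; rewrite !rmorphD /= map_polyXn map_polyX rmorph1 !hornerE.
    rewrite omega_sqr; ring.
  apply: integralC_add; first exact: integralC_int.
  by apply: integralC_mul => //; exact: integralC_int.
move=> [[a [b ->]]] hz.
have hzJ := integral_conj hz.
have rJ c : Num.conj (ratr c : C) = ratr c by rewrite fmorph_rat.
have JE (x y : C) : Num.conj x = x -> Num.conj y = y ->
    Num.conj (x + y * (1 + 2 * omega)) = x - y * (1 + 2 * omega).
  move=> hx hy; rewrite rmorphD rmorphM /= hx hy rmorphD rmorphM rmorph1 rmorph_nat /=.
  by rewrite conj_omega; ring.
rewrite JE // in hzJ.
have [m hm] : exists m : int, 2 * a = m%:~R.
  apply: integral_ratr; have := integralC_add hz hzJ.
  congr integralOver; rewrite rmorphM /= ratr_nat; ring.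
have [n hn] : exists n : int, a ^+ 2 + 3 * b ^+ 2 = n%:~R.
  apply: integral_ratr; have := integralC_mul hz hzJ.
  congr integralOver; rewrite rmorphD rmorphM !rmorphXn /= ratr_nat.
  have h := omega_sqr; ring: h.
have [q hq] : exists q : int, 2 * b = q%:~R.
  apply: (@sqr3_rat_int _ (4 * n - m ^+ 2)).
  rewrite rmorphB rmorphM rmorphXn /= -hn -hm; ring.
have e : m ^+ 2 + 3 * q ^+ 2 = 4 * n.
  apply/eqP; rewrite -(eqr_int rat); apply/eqP.
  rewrite !(rmorphM, rmorphD, rmorphXn) /= -hn -hm -hq; ring.
(* Divisibility of [m ^+ 2 + 3 * q ^+ 2] by 4 gives [m] and [q] the same parity. *)
have [k hk] : exists k : int, m + q = 2 * k.
  exists ((m + q) %/ 2)%Z; nia.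
(* [a + b * (1 + 2 * omega) = (a + b) + (2 * b) * omega], with [a + b = (m + q) / 2 = k]. *)
exists k, q.
have -> : a = (m%:~R) / 2 by rewrite -hm; field.
have -> : b = (q%:~R) / 2 by rewrite -hq; field.
rewrite !(rmorphM, fmorphV) /= !ratr_int ratr_nat.
have : (m + q)%:~R = (2 * k)%:~R :> C by rewrite hk.
rewrite rmorphD rmorphM /= => hC.
have -> : k%:~R = (m%:~R + q%:~R) / 2 :> C by rewrite hC; field.
by field.
Qed.

Lemma eis_mul_conj_int q : eis q -> exists n : int, q * Num.conj q = n%:~R.
Proof. by move=> /nsq_nat[n hn]; exists n; rewrite mul_conjE hn rmorph_nat. Qed.

Lemma quadratic_field_div_int (n : int) u : n != 0 -> eis (n%:~R * u) -> quadratic_field 3 u.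
Proof.
move=> n0 [x [y e]].
have nC : n%:~R != 0 :> C by rewrite intr_eq0.
have -> : u = (x%:~R + y%:~R * omega) / n%:~R by rewrite -e mulrC mulKf.
rewrite /quadratic_field /= sqrt3_omega.
exists ((x%:~R - y%:~R / 2) / n%:~R), (y%:~R / 2 / n%:~R).
rewrite !(rmorphB, rmorphM, fmorphV) /= !ratr_int ratr_nat; by field.
Qed.

(** Multiplying [q * u] by the conjugate of [q] makes the denominator a rational integer, so [u]
    lies in Q(omega), where integral elements are Eisenstein. *)
Lemma eis_integral q u :
  q != 0 -> eis q -> eis (q * u) -> integralC u -> eis u.
Proof.
move=> q0 eq equ iu; apply/ring_of_integers_eis; split=> //.
have [n hn] := eis_mul_conj_int eq; apply: (@quadratic_field_div_int n).
  apply: contra_neq q0 => n0; move: hn; rewrite n0 mul_conjE => /complexI/eqP.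
  by rewrite nsq_eq0 => /eqP.
by rewrite -hn mulrAC; apply: eisM => //; apply: eisJ.
Qed.

Lemma integralC_eis u : eis u -> integralC u.
Proof. by move=> /ring_of_integers_eis[]. Qed.

(** Transitivity of integrality, for characteristic polynomials of Eisenstein matrices: their
    coefficients are integral over Z but need not lie in Z. *)
Lemma integralC_cubic_root t s d u :
  integralC t -> integralC s -> integralC d ->
  u ^+ 3 - t * u ^+ 2 + s * u - d = 0 -> integralC u.
Proof.
move=> it iss id e.
have iN x : integralC x -> integralC (- x).
  by move=> hx; rewrite -mulN1r; apply: integralC_mul => //; exact: (integralC_int (-1)).
apply: (@integral_root_monic int C intr _ (Poly [:: - d; s; - t; 1])).
- by rewrite monicE lead_coefE (PolyK (c := 1)) ?oner_eq0.
- by rewrite rootE horner_Poly /= -[X in _ == X]e; apply/eqP; ring.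
- rewrite (PolyK (c := 1)) ?oner_eq0 //= => x; rewrite !inE.
  by case/or4P => /eqP ->; [exact: iN|done|exact: iN|exact: (integralC_int 1)].
Qed.

(** * Units of the Eisenstein integers *)

Lemma eis_unit_pow u : eis u -> nsq u = 1 ->
  exists2 k, (k < 6)%N & u = (1 + omega) ^+ k.
Proof.
move=> [x [y ->]]; rewrite nsq_intr => h.
have {h}: (x ^+ 2 - x * y + y ^+ 2)%:~R = 1%:~R :> R by [].
move/eqP; rewrite eqr_int => /eqP h.
have [hx hy]: `|x| <= 1 /\ `|y| <= 1 by split; nia.
have o2 := omega_sqr.
have o3 : omega ^+ 3 = 1 by ring: o2.
have: [\/ (x, y) = (1, 0), (x, y) = (1, 1) | (x, y) = (0, 1)] \/
   [\/ (x, y) = (-1, 0), (x, y) = (-1, -1) | (x, y) = (0, -1)].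
  have: x = -1 \/ x = 0 \/ x = 1 by lia.
  have: y = -1 \/ y = 0 \/ y = 1 by lia.
  move: h => /[swap] -[|[]] -> /[swap] -[|[]] -> //= _;
  by [left; constructor|right; constructor].
(* [1 + omega = - omega ^+ 2] is a primitive sixth root of unity, so its powers run through the six
   points. *)
by case=> -[] [-> ->];
 [exists 0%N|exists 1%N|exists 2|exists 3|exists 4|exists 5] => //; ring: o2.
Qed.

(** Each difference has real coordinates, not both zero, in the basis [1, omega], on which the norm
    form is definite. *)
Lemma omega_pow_neq1 k : (0 < k < 6)%N -> (1 + omega) ^+ k != 1.
Proof.
have o2 := omega_sqr.
have n0 (x y : R) : (x != 0) || (y != 0) -> x%:C%C + y%:C%C * omega != 0.
  move=> xy; rewrite -nsq_eq0 nsq_real_omega; apply/eqP => h.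
  have y0 : y ^+ 2 = 0 by have := sqr_ge0 (x - y / 2); have := sqr_ge0 y; nra.
  have {}y0 : y = 0 by apply/eqP; rewrite -sqrf_eq0 y0.
  have x0 : x ^+ 2 = 0 by rewrite y0 in h; lra.
  have {}x0 : x = 0 by apply/eqP; rewrite -sqrf_eq0 x0.
  by move: xy; rewrite x0 y0 eqxx.
rewrite -subr_eq0; case: k => [|[|[|[|[|[|k]]]]]] //= _.
- have : 0%:C%C + 1%:C%C * omega != 0 by apply: n0; rewrite oner_neq0 orbT.
  by congr (_ != 0); ring.
- have : (-1)%:C%C + 1%:C%C * omega != 0 by apply: n0; rewrite oner_neq0 orbT.
  by congr (_ != 0); rewrite !rmorphN; ring: o2.
- have : (-2)%:C%C + 0%:C%C * omega != 0 by apply: n0; rewrite oppr_eq0 pnatr_eq0.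
  by congr (_ != 0); rewrite !rmorphN rmorph_nat; ring: o2.
- have : (-2)%:C%C + (-1)%:C%C * omega != 0 by apply: n0; rewrite oppr_eq0 pnatr_eq0.
  by congr (_ != 0); rewrite !rmorphN rmorph_nat; ring: o2.
- have : (-1)%:C%C + (-1)%:C%C * omega != 0 by apply: n0; rewrite oppr_eq0 oner_neq0.
  by congr (_ != 0); rewrite !rmorphN; ring: o2.
Qed.

End Eisenstein.

(** * Hermitian geometry of mirrors *)

Section Hermitian.
Variable R : realType.
Local Notation C := R[i].
Implicit Types (u v w : 'cV[C]_3).

Lemma sum3 (V : nmodType) (F : 'I_3 -> V) : \sum_i F i = F 0 + F 1 + F 2.
Proof.
rewrite !big_ord_recr big_ord0 /=. rewrite add0r.
by congr (F _ + F _ + F _); apply/val_inj.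
Qed.

Lemma ord3P (P : 'I_3 -> Prop) : P 0 -> P 1 -> P 2 -> forall i, P i.
Proof.
move=> h0 h1 h2 [[|[|[|//]]] h].
- by rewrite (_ : Ordinal h = 0) //; apply/val_inj.
- by rewrite (_ : Ordinal h = 1) //; apply/val_inj.
- by rewrite (_ : Ordinal h = 2) //; apply/val_inj.
Qed.

Lemma colP3 u v : u 0 0 = v 0 0 -> u 1 0 = v 1 0 -> u 2 0 = v 2 0 -> u = v.
Proof. by move=> h0 h1 h2; apply/colP; exact: ord3P. Qed.

Lemma vec3E a b c :
  (vec3 a b c 0 0 = a :> C) * (vec3 a b c 1 0 = b :> C) * (vec3 a b c 2 0 = c :> C).
Proof. by rewrite !mxE. Qed.

Lemma hermE v w : herm v w =
  v 0 0 * Num.conj (w 2 0) + v 1 0 * Num.conj (w 1 0) + v 2 0 * Num.conj (w 0 0).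
Proof.
rewrite /herm mxE sum3 !mxE !sum3 !mxE /=. ring.
Qed.

Lemma hermDr v u w : herm v (u + w) = herm v u + herm v w.
Proof. by rewrite !hermE !mxE !rmorphD /=; ring. Qed.

Lemma hermZr v a w : herm v (a *: w) = Num.conj a * herm v w.
Proof. by rewrite !hermE !mxE !rmorphM /=; ring. Qed.

Lemma herm_conj v w : herm v w = Num.conj (herm w v).
Proof. by rewrite !hermE !rmorphD !rmorphM /= !conjCK; ring. Qed.

Lemma hermDl v u w : herm (v + u) w = herm v w + herm u w.
Proof. by rewrite !hermE !mxE; ring. Qed.

Lemma hermZl v a w : herm (a *: v) w = a * herm v w.
Proof. by rewrite !hermE !mxE; ring. Qed.

Lemma herm0r v : herm v 0 = 0.
Proof. by rewrite -[in LHS](scale0r v) hermZr rmorph0 mul0r. Qed.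

Lemma hermBr v u w : herm v (u - w) = herm v u - herm v w.
Proof. by rewrite -scaleN1r hermDr hermZr rmorphN1 mulN1r. Qed.

Lemma hermBl v u w : herm (v - u) w = herm v w - herm u w.
Proof. by rewrite -scaleN1r hermDl hermZl mulN1r. Qed.

Lemma herm_eq0C v w : herm v w = 0 -> herm w v = 0.
Proof. by move=> h; rewrite herm_conj h rmorph0. Qed.

Lemma herm_nondeg v : (forall u, herm v u = 0) -> v = 0.
Proof.
move=> h; apply: colP3; rewrite [RHS]mxE.
- by have := h (vec3 0 0 1); rewrite hermE !vec3E !rmorph0 rmorph1 !mulr0 !addr0 mulr1.
- by have := h (vec3 0 1 0); rewrite hermE !vec3E !rmorph0 rmorph1 !mulr0 add0r addr0 mulr1.
- by have := h (vec3 1 0 0); rewrite hermE !vec3E !rmorph0 rmorph1 !mulr0 !add0r mulr1.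
Qed.

Lemma herm_UJ (A : UJ R) v w : herm (UJval A *m v) (UJval A *m w) = herm v w.
Proof.
case/andP: (UJvalP A) => _ /eqP hA.
by rewrite /herm adjmxM -!mulmxA (mulmxA (J R)) (mulmxA (adjmx A)) (mulmxA (adjmx A)) hA.
Qed.

(** [herm v v] is real because the form is Hermitian; taking its real part moves inequalities to
    [R]. *)
Definition hsq v : R := complex.Re (herm v v).

Lemma hsqE v : herm v v = (hsq v)%:C%C.
Proof.
rewrite /hsq; have : Num.conj (herm v v) = herm v v by rewrite -herm_conj.
by case: (herm v v) => a b; rewrite conjE => -[hb]; congr Complex; rewrite /=; lra.
Qed.

Lemma herm_lt0 v : (herm v v < 0) = (hsq v < 0).
Proof. by rewrite hsqE -ltcR. Qed.

Lemma herm_gt0 v : (0 < herm v v) = (0 < hsq v).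
Proof. by rewrite hsqE -ltcR. Qed.

Lemma hsqZ a v : hsq (a *: v) = nsq a * hsq v.
Proof.
apply: (@complexI R); rewrite -hsqE hermZl hermZr mulrA mul_conjE.
by rewrite hsqE rmorphM.
Qed.

Lemma hsqD (t : R) u v :
  hsq (u + t%:C%C *: v) = hsq u + 2 * t * complex.Re (herm u v) + t ^+ 2 * hsq v.
Proof.
rewrite /hsq !(hermDl, hermDr, hermZl, hermZr) (herm_conj v u).
case: (herm u u) (herm u v) (herm v v) => [a1 b1] [a2 b2] [a3 b3] /=; ring.
Qed.

(** The form has signature (2, 1): projecting the vector [(1, 0, -1)], of norm -2, off a positive
    [w] cannot increase its norm. *)
Lemma neg_perp w : 0 < herm w w -> exists2 v, herm v v < 0 & herm v w = 0.
Proof.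
move=> w0; have wn0 : herm w w != 0 by rewrite gt_eqF.
pose u : 'cV[C]_3 := vec3 1 0 (-1).
have hu : herm u u = - 2.
  by rewrite hermE !vec3E rmorphN rmorph1 rmorph0; ring.
have pw : herm (u - (herm u w / herm w w) *: w) w = 0.
  by rewrite hermBl hermZl mulfVK // subrr.
exists (u - (herm u w / herm w w) *: w) => //.
rewrite hermBr hermZr pw mulr0 subr0 hermBl hermZl hu.
rewrite (herm_conj w u) mulrAC mul_conjE hsqE.
have -> : - 2 - (nsq (herm u w))%:C%C / (hsq w)%:C%C
    = (- 2 - nsq (herm u w) / hsq w)%:C%C.
  by rewrite rmorphB rmorphN rmorph_nat rmorphM fmorphV.
rewrite ltcR; rewrite herm_gt0 in w0.
have := divr_ge0 (nsq_ge0 (herm u w)) (ltW w0); lra.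
Qed.

Lemma quadratic_eventually_neg (q r h : R) : 0 < q ->
  exists t, [/\ t != 0, h + 2 * t * r - t ^+ 2 * q < 0 & h - 2 * t * r - t ^+ 2 * q < 0].
Proof.
(* With this [t], [t * q = q + 2 * |r| + |h|] and [t >= 1], so [t ^+ 2 * q] exceeds
   [2 * t * |r| + |h|]. *)
move=> q0; exists (1 + (2 * `|r| + `|h|) / q).
have := divr_ge0 (addr_ge0 (mulr_ge0 (ler0n R 2) (normr_ge0 r)) (normr_ge0 h)) (ltW q0).
have : (2 * `|r| + `|h|) / q * q = 2 * `|r| + `|h| by rewrite divfK // gt_eqF.
move: (_ / q) (ler_norm r) (ler_norm (- r)) (ler_norm h) (normr_ge0 r) (normr_ge0 h).
rewrite normrN; move: `|r| `|h| => r' h' u hr hr' hh r0 h0 uq u0.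
have key : h + 2 * (1 + u) * r' - (1 + u) ^+ 2 * q < 0.
  have -> : (1 + u) ^+ 2 * q = (1 + u) * (q + u * q) by ring.
  rewrite uq; have := mulr_ge0 u0 h0; have := mulr_ge0 u0 (ltW q0); lra.
have ur : 0 <= u * (r' - r) by rewrite mulr_ge0 // subr_ge0.
have ur' : 0 <= u * (r' + r) by rewrite mulr_ge0 //; lra.
by split; [rewrite gt_eqF //; lra|lra|lra].
Qed.

Lemma neg_shift v0 v : hsq v0 < 0 ->
  exists t : R, [/\ t != 0, hsq (v + t%:C%C *: v0) < 0 & hsq (v - t%:C%C *: v0) < 0].
Proof.
move=> h; have q0 : 0 < - hsq v0 by rewrite oppr_gt0.
have [t [t0 h1 h2]] := quadratic_eventually_neg (complex.Re (herm v v0)) (hsq v) q0.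
exists t; split=> //; first by rewrite hsqD; lra.
by rewrite -scaleNr -rmorphN hsqD; lra.
Qed.

(** * Mirrors and their polar vectors *)

Lemma mirror_line w v : herm v v < 0 -> herm v w = 0 -> mirror w <[v]>%VS.
Proof.
move=> v0 vw; split; first by exists v.
by move=> _ /vlineP[k ->]; rewrite hermZl vw mulr0.
Qed.

Lemma mirrorP w (L : {vspace 'cV[C]_3}) :
  mirror w L <-> exists v, [/\ herm v v < 0, herm v w = 0 & L = <[v]>%VS].
Proof.
split=> [[[v [v0 ->]] h]|[v [v0 vw ->]]]; last exact: mirror_line.
by exists v; split=> //; apply: h; exact: memv_line.
Qed.

(** Negative vectors span the orthogonal of [w]: any [v] there is half the sum of [v + t v0] and
    [v - t v0], both negative for a suitable [t]. *)
Lemma perp_of_neg w (P : 'cV[C]_3 -> Prop) :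
  0 < herm w w ->
  (forall u v, P u -> P v -> P (u + v)) -> (forall a u, P u -> P (a *: u)) ->
  (forall v, herm v v < 0 -> herm v w = 0 -> P v) ->
  forall v, herm v w = 0 -> P v.
Proof.
move=> w0 PD PZ Pn v vw; have [v0 hv0 v0w] := neg_perp w0.
rewrite herm_lt0 in hv0; have [t [t0 h1 h2]] := neg_shift v hv0.
have -> : v = 2^-1 *: (v + t%:C%C *: v0 + (v - t%:C%C *: v0)).
  by rewrite addrACA subrr addr0 -mulr2n -[v *+ 2](scaler_nat 2) scalerA mulVf ?scale1r ?pnatr_eq0.
apply/PZ/PD; apply: Pn; rewrite ?herm_lt0 //.
  by rewrite hermDl hermZl vw v0w mulr0 addr0.
by rewrite hermBl hermZl vw v0w mulr0 subr0.
Qed.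

(** By the spanning property, the orthogonal of [w] lies in that of [w']; nondegeneracy then makes
    the polar vectors proportional. *)
Lemma mirror_sub_collinear w w' : 0 < herm w w ->
  (mirror w `<=` mirror w')%classic -> exists c, w' = c *: w.
Proof.
move=> w0 sub; have wn0 : herm w w != 0 by rewrite gt_eqF.
have perp v : herm v w = 0 -> herm v w' = 0.
  apply: (perp_of_neg w0 (P := fun v => herm v w' = 0)) => [x y hx hy|a x hx|x x0 xw].
  - by rewrite hermDl hx hy addr0.
  - by rewrite hermZl hx mulr0.
  - have /sub[_] := mirror_line x0 xw; apply; exact: memv_line.
pose c := herm w' w / herm w w; exists c; apply/eqP; rewrite -subr_eq0; apply/eqP.
have wv : herm w (w' - c *: w) = 0.
  by apply: herm_eq0C; rewrite hermBl hermZl mulfVK // subrr.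
apply: herm_nondeg => x; apply: herm_eq0C.
have xw : herm (x - (herm x w / herm w w) *: w) w = 0.
  by rewrite hermBl hermZl mulfVK // subrr.
rewrite -(subrK ((herm x w / herm w w) *: w) x) hermDl hermZl wv mulr0 addr0.
by rewrite hermBr hermZr xw (perp _ xw) mulr0 subrr.
Qed.

(** Fixing lines gives an eigenvalue for each negative vector, a priori depending on it. Comparing
    [v0] with [v + t v0] and [v - t v0] shows that [v] has the eigenvalue of [v0]. *)
Lemma fixes_pointwise_scalar (A : UJ R) w : 0 < herm w w ->
  fixes_pointwise (\pi_(PU R)%qT A) (mirror w) ->
  exists mu, forall v, herm v w = 0 -> UJval A *m v = mu *: v.
Proof.
move=> w0 fixA; have wn0 : herm w w != 0 by rewrite gt_eqF.
have eig v : hsq v < 0 -> herm v w = 0 -> exists c, UJval A *m v = c *: v.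
  move=> v0 vw; have := fixA _ (mirror_line _ vw); rewrite herm_lt0 => /(_ v0).
  rewrite PU_actE UJ_act_line => e.
  by have := memv_line (UJval A *m v); rewrite e => /vlineP.
have [v0 hv0 v0w] := neg_perp w0; rewrite herm_lt0 in hv0.
have [mu hmu] := eig _ hv0 v0w; exists mu => v vw.
have [t [t0 h1 h2]] := neg_shift v hv0.
set tc := t%:C%C in h1 h2.
have tc0 : tc != 0 by rewrite /tc fmorph_eq0.
have [c hc] : exists c, UJval A *m (v + tc *: v0) = c *: (v + tc *: v0).
  by apply: eig => //; rewrite hermDl hermZl vw v0w mulr0 addr0.
have [d hd] : exists d, UJval A *m (v - tc *: v0) = d *: (v - tc *: v0).
  by apply: eig => //; rewrite hermBl hermZl vw v0w mulr0 subr0.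
(* The sum of the two relations reads (c + d - 2 mu) v + (c - d) t v0 = 0. *)
have Av : UJval A *m v = c *: v + (c - mu) *: (tc *: v0).
  move: hc; rewrite mulmxDr -scalemxAr hmu => /(canRL (addrK _)) ->.
  by rewrite scalerDr scalerBl -addrA [_ *: (mu *: _)]scalerA mulrC -scalerA.
have Av' : UJval A *m v = d *: v - (d - mu) *: (tc *: v0).
  move: hd; rewrite mulmxBr -scalemxAr hmu => /(canRL (subrK _)) ->.
  rewrite scalerBr scalerBl opprB [_ *: (mu *: _)]scalerA (mulrC tc) -scalerA.
  by rewrite addrA addrAC.
have e : (c - d) *: v = (2 * mu - c - d) *: (tc *: v0).
  apply/colP => i; have /colP/(_ i) := Av'; rewrite Av !mxE => /eqP.
  rewrite -subr_eq0 => /eqP h; apply/eqP; rewrite -subr_eq0; apply/eqP.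
  rewrite -[RHS]h; ring.
(* If [c = d], then [v0 != 0] forces this value to be [mu]; otherwise [v] is a multiple of [v0]. *)
have [cd|ncd] := eqVneq c d.
  have : (2 * mu - c - d) *: (tc *: v0) = 0 by rewrite -e cd subrr scale0r.
  have tv0 : tc *: v0 != 0.
    rewrite scaler_eq0 (negPf tc0) /=; apply: contraTneq hv0 => ->.
    by rewrite -herm_lt0 herm0r ltxx.
  move/eqP; rewrite scaler_eq0 (negPf tv0) orbF -cd => /eqP h.
  have cm : c = mu.
    have -> : c = mu - (2 * mu - c - c) / 2 by field.
    by rewrite h mul0r subr0.
  by rewrite Av cm subrr scale0r addr0.
have cd0 : c - d != 0 by rewrite subr_eq0.
have -> : v = ((c - d)^-1 * (2 * mu - c - d) * tc) *: v0.
  by rewrite -2!scalerA -e scalerA mulVf ?scale1r.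
by rewrite -scalemxAr hmu !scalerA mulrC.
Qed.

(** Unitarity makes [w] an eigenvector, of value [nu]; splitting [x] along [w] and its orthogonal
    gives [k = (nu - mu) / herm w w]. Eigenvalues on vectors of nonzero norm have modulus one. *)
Lemma reflection_form (A : UJ R) w : 0 < herm w w ->
  fixes_pointwise (\pi_(PU R)%qT A) (mirror w) ->
  exists mu k, [/\ forall x, UJval A *m x = mu *: x + (k * herm x w) *: w,
    nsq mu = 1 & nsq (mu + k * herm w w) = 1].
Proof.
move=> w0 fixA; have wn0 : herm w w != 0 by rewrite gt_eqF.
have [mu hmu] := fixes_pointwise_scalar w0 fixA.
have nsq1 a v : hsq v != 0 -> UJval A *m v = a *: v -> nsq a = 1.
  move=> v0 e; have := herm_UJ A v v; rewrite e hsqE hsqE => /complexI.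
  by rewrite hsqZ => /(canRL (mulfK v0)) ->; rewrite divff.
have [v0 hv0 v0w] := neg_perp w0.
have mu1 : nsq mu = 1.
  by apply: (nsq1 _ v0 _ (hmu _ v0w)); rewrite lt_eqF -?herm_lt0.
have mu0 : mu != 0 by rewrite -nsq_eq0 mu1 oner_neq0.
have perp x : herm (x - (herm x w / herm w w) *: w) w = 0.
  by rewrite hermBl hermZl mulfVK // subrr.
(* [A w] minus its projection on [w] is orthogonal to [w], and also to each [z] in the orthogonal of
   [w], because [A z = mu z] with [mu != 0]. *)
have [nu hnu] : exists nu, UJval A *m w = nu *: w.
  set Aw := UJval A *m w; exists (herm Aw w / herm w w).
  apply/eqP; rewrite -subr_eq0; apply/eqP/herm_nondeg => x.
  set y := Aw - _; have yw : herm y w = 0 by exact: perp.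
  rewrite -(subrK ((herm x w / herm w w) *: w) x) hermDr hermZr yw mulr0 addr0.
  set z := x - _; have zw : herm z w = 0 by exact: perp.
  rewrite /y hermBl hermZl (herm_eq0C zw) mulr0 subr0.
  have : herm Aw (UJval A *m z) = 0 by rewrite herm_UJ (herm_eq0C zw).
  rewrite hmu // hermZr => /eqP; rewrite mulf_eq0 => /orP[|/eqP //].
  by rewrite conjC_eq0 (negPf mu0).
exists mu, ((nu - mu) / herm w w); split=> [x|//|].
- rewrite -[in LHS](subrK ((herm x w / herm w w) *: w) x) mulmxDr hmu //.
  rewrite -scalemxAr hnu scalerBr -addrA; congr (_ + _).
  by rewrite !scalerA -scaleNr -scalerDl; congr (_ *: _); field.
- rewrite mulfVK // addrC subrK; apply: (nsq1 _ w _ hnu).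
  by rewrite herm_gt0 in w0; rewrite gt_eqF.
Qed.

End Hermitian.

(** * Integrality of the eigenvalues and the primitive polar vector *)

Section Integrality.
Variable R : realType.
Local Notation C := R[i].
Implicit Types (u v w : 'cV[C]_3).

Definition eisv v := forall i, eis (v i 0).

Lemma eisvZ a v : eis a -> eisv v -> eisv (a *: v).
Proof. by move=> ha hv i; rewrite mxE; apply: eisM. Qed.

Lemma eisvB u v : eisv u -> eisv v -> eisv (u - v).
Proof. by move=> hu hv i; rewrite !mxE; apply: eisB. Qed.

Lemma eis_nat n : eis (n%:R : C).
Proof. exact: (eis_int R n). Qed.

Lemma eis_herm u v : eisv u -> eisv v -> eis (herm u v).
Proof. by move=> hu hv; rewrite hermE; do !apply: eisD; apply: eisM => //; apply: eisJ. Qed.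

Lemma mx_integralP (A : 'M[C]_3) : mx_integral 3 A <-> forall i j, eis (A i j).
Proof. by split=> h i j; apply/ring_of_integers_eis; exact: h. Qed.

Lemma mulmx_integral (A : 'M[C]_3) v : mx_integral 3 A -> eisv v -> eisv (A *m v).
Proof.
move=> /mx_integralP hA hv i; rewrite mxE sum3.
by do !apply: eisD; apply: eisM.
Qed.

Lemma eisv_delta (i : 'I_3) : eisv (delta_mx i 0 : 'cV[C]_3).
Proof. by move=> j; rewrite mxE; exact: eis_nat. Qed.

Lemma eigenvalue_eis (A : 'M[C]_3) mu k w :
  mx_integral 3 A -> k * herm w w != 0 ->
  (forall x, A *m x = mu *: x + (k * herm x w) *: w) ->
  eis mu /\ eis (k * herm w w).
Proof.
move=> /mx_integralP hA; set s := k * herm w w => s0 e.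
have entry i j : A i j = mu * (i == j)%:R + k * herm (delta_mx j 0) w * w i 0.
  have /colP/(_ i) := e (delta_mx j 0); rewrite -colE !mxE eqxx andbT => ->.
  by [].
(* Up to sign, [T], [S] and [D] are the coefficients of the characteristic polynomial: trace, sum of
   principal minors, determinant. *)
pose T := A 0 0 + A 1 1 + A 2 2.
pose S := A 0 0 * A 1 1 - A 0 1 * A 1 0 + (A 0 0 * A 2 2 - A 0 2 * A 2 0)
  + (A 1 1 * A 2 2 - A 1 2 * A 2 1).
pose D := A 0 0 * (A 1 1 * A 2 2 - A 1 2 * A 2 1)
  - A 0 1 * (A 1 0 * A 2 2 - A 1 2 * A 2 0)
  + A 0 2 * (A 1 0 * A 2 1 - A 1 1 * A 2 0).
have eT : eis T by do !apply: eisD.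
have eS : eis S by repeat first [exact: hA | apply: eisB | apply: eisD | apply: eisM].
have eD : eis D by repeat first [exact: hA | apply: eisB | apply: eisD | apply: eisM].
have hs : s = k * (herm (delta_mx 0 0) w * w 0 0 + herm (delta_mx 1 0) w * w 1 0
    + herm (delta_mx 2 0) w * w 2 0).
  by rewrite /s !hermE !mxE /=; ring.
have TE : T = 3 * mu + s by rewrite /T !entry hs /=; ring.
have SE : S = 3 * mu ^+ 2 + 2 * mu * s by rewrite /S !entry hs /=; ring.
have DE : D = mu ^+ 3 + mu ^+ 2 * s by rewrite /D !entry hs /=; ring.
have emu : eis mu.
  (* The double root is [(T * S - 9 * D) / (2 * (T ^+ 2 - 3 * S))], whose denominator is
     [2 * s ^+ 2]. *)
  apply: (@eis_integral _ (2 * (T ^+ 2 - 3 * S))).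
  - have -> : 2 * (T ^+ 2 - 3 * S) = 2 * s ^+ 2 by rewrite TE SE; ring.
    by rewrite mulf_neq0 ?pnatr_eq0 ?sqrf_eq0.
  - apply: eisM; first exact: eis_nat.
    by apply: eisB; apply: eisM => //; exact: eis_nat.
  - have -> : 2 * (T ^+ 2 - 3 * S) * mu = T * S - 9 * D by rewrite TE SE DE; ring.
    by apply: eisB; apply: eisM => //; exact: eis_nat.
  - apply: (@integralC_cubic_root _ T S D); try exact: integralC_eis.
    by rewrite TE SE DE; ring.
split=> //; have -> : s = T - 3 * mu by rewrite TE; ring.
by apply: eisB => //; apply: eisM => //; exact: eis_nat.
Qed.

Lemma eis_no_infinite_descent (P : C -> Prop) : (forall c, P c -> eis c) ->
  (forall c, P c -> exists2 c', P c' & nsq c' < nsq c) -> forall c, ~ P c.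
Proof.
move=> Pe step c Pc; have [n hn] := nsq_nat (Pe _ Pc).
elim/ltn_ind: n c Pc hn => n IH c Pc hn.
have [c' Pc' lt'] := step _ Pc; have [m hm] := nsq_nat (Pe _ Pc').
by apply: (IH m _ c') => //; rewrite hn hm ltr_nat in lt'.
Qed.

(* By Euclidean division, the multiples of [v] that are
   integral form a free module of rank one. *)
Lemma primitive_multiple v : v != 0 -> eisv v -> exists c, [/\ c != 0, eisv (c *: v)
  & forall l, eisv (l *: (c *: v)) -> eis l].
Proof.
move=> v0 hv; have [i vi] : exists i, v i 0 != 0.
  by move/cV0Pn: v0.
apply: contrapT => none.
(* [P] collects the [i]-th coordinates of the nonzero integral multiples of [v]; if none of these is
   primitive, the norm descends forever. *)
pose P (a : C) := exists c, [/\ c != 0, eisv (c *: v) & a = c * v i 0].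
apply: (@eis_no_infinite_descent P _ _ (v i 0)); last by exists 1; rewrite oner_neq0 scale1r mul1r.
  by move=> a [c [_ h ->]]; have := h i; rewrite mxE.
move=> a [c [c0 hc ->]].
have [l hl nl] : exists2 l, eisv (l *: (c *: v)) & ~ eis l.
  apply: contrapT => h; apply: none; exists c; split=> // l hl.
  by apply: contrapT => nl; apply: h; exists l.
(* Replacing [l] by [l - q] keeps the multiple integral and scales the coordinate by a factor of
   norm less than one. *)
have [q eq qlt] := eis_round l.
have lq0 : l - q != 0 by apply/eqP => /eqP; rewrite subr_eq0 => /eqP e; apply: nl; rewrite e.
exists ((l - q) * c * v i 0).
  exists ((l - q) * c); split=> //; first by rewrite mulf_neq0.
  by rewrite -scalerA scalerBl; apply: eisvB => //; apply: eisvZ.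
rewrite -mulrA nsqM gtr_pMl // lt0r nsq_ge0 nsq_eq0 mulf_neq0 //.
Qed.

Lemma herm_self_int v : eisv v -> exists n : int, hsq v = n%:~R.
Proof.
move=> hv; have [x [y e]] := eis_herm hv hv; move: e; rewrite hsqE !intrC.
have s0 : Num.sqrt 3 != 0 :> R by rewrite sqrtr_eq0 -ltNge.
move=> [h1 h2]; exists x; rewrite h1.
have y0 : y%:~R * Num.sqrt 3 = 0 :> R by lra.
have {}y0 : y%:~R = 0 :> R by apply/eqP; move/eqP: y0; rewrite mulf_eq0 (negPf s0) orbF.
by rewrite y0; ring.
Qed.

Lemma nsq_sub_le (a b : C) : nsq (a - b) <= 2 * nsq a + 2 * nsq b.
Proof.
case: a b => [a1 a2] [b1 b2]; rewrite /nsq /=.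
have := sqr_ge0 (a1 + b1); have := sqr_ge0 (a2 + b2); nra.
Qed.

Lemma nsq_ge1 (a : C) : eis a -> a != 0 -> 1 <= nsq a.
Proof.
move=> /nsq_nat[n hn]; rewrite -nsq_eq0 hn pnatr_eq0 => n0.
by rewrite ler1n lt0n.
Qed.

Lemma nsq_real (x : R) : nsq x%:C%C = x ^+ 2.
Proof. by rewrite /nsq /= expr0n addr0. Qed.

Lemma int_sqr_le4 (n : int) : 0 < n -> n ^+ 2 <= 4 -> n = 1 \/ n = 2.
Proof. nia. Qed.

(** For a primitive multiple [v] of [w], with coefficient [k'], the bounds [1 <= |k'|] and
    [|k' * herm v v| <= 2] leave 1 and 2 for the positive integer [hsq v]. *)
Lemma reflection_primitive (A : UJ R) w :
  mx_integral 3 (UJval A) -> 0 < herm w w ->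
  fixes_pointwise (\pi_(PU R)%qT A) (mirror w) -> \pi_(PU R)%qT A <> 1%g ->
  exists c, [/\ c != 0, eisv (c *: w) & hsq (c *: w) = 1 \/ hsq (c *: w) = 2].
Proof.
move=> hA w0 fixA ne1; have [mu [k [e mu1 nu1]]] := reflection_form w0 fixA.
have k0 : k != 0.
  apply/eqP => k0; apply: ne1; apply/(PU_eqP A 1%g); exists mu.
  apply/matrixP => i j.
  have /colP/(_ i) := e (delta_mx j 0); rewrite k0 mul0r scale0r addr0 -colE !mxE.
  by rewrite eqxx andbT.
have [emu es] := eigenvalue_eis hA (mulf_neq0 k0 (lt0r_neq0 w0)) e.
(* The rank-one part [A - mu] preserves integral vectors; its values are integral multiples of
   [w]. *)
have col x : eisv x -> eisv ((k * herm x w) *: w).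
  move=> hx; have -> : (k * herm x w) *: w = UJval A *m x - mu *: x.
    by rewrite e addrC addKr.
  by apply: eisvB; [apply: mulmx_integral|apply: eisvZ].
have wn0 : w != 0 by apply: contraTneq w0 => ->; rewrite herm0r ltxx.
have [j hj] : exists j : 'I_3, herm (delta_mx j 0) w != 0.
  apply: contrapT => h; case/negP: wn0; apply/eqP.
  have h' j : herm (delta_mx j 0) w = 0.
    by apply: contrapT => /eqP hj; apply: h; exists j.
  have := w0; suff -> : herm w w = 0 by rewrite ltxx.
  have -> : herm w w = w 0 0 * herm (delta_mx 0 0) w + w 1 0 * herm (delta_mx 1 0) w
    + w 2 0 * herm (delta_mx 2 0) w by rewrite !hermE !mxE /=; ring.
  by rewrite !h' !mulr0 !addr0.
set d := k * herm (delta_mx j 0) w.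
have d0 : d != 0 by rewrite mulf_neq0.
have [c [c0 hc prim]] : exists c, [/\ c != 0, eisv (c *: (d *: w))
    & forall l, eisv (l *: (c *: (d *: w))) -> eis l].
  apply: primitive_multiple; first by rewrite scaler_eq0 (negPf d0) (negPf wn0).
  exact/col/eisv_delta.
exists (c * d); set f := c * d; rewrite scalerA -/f in hc; set v := f *: w in hc *.
have {}prim l : eisv (l *: v) -> eis l by rewrite /v /f -scalerA; exact: prim.
have f0 : f != 0 by rewrite mulf_neq0.
(* The rank-one map is unchanged when [w] becomes [f *: w] and [k] becomes [k / |f|^2]. *)
split=> //; pose k' := k / (nsq f)%:C%C.
have nf0 : (nsq f)%:C%C != 0 :> C by rewrite fmorph_eq0 nsq_eq0.
have k'E x : k' * herm x v * f = k * herm x w.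
  rewrite /v hermZr /k' -mul_conjE; field.
  by rewrite conjC_eq0 f0.
have ek x : eisv x -> eis (k' * herm x v).
  move=> hx; apply: prim; rewrite /v scalerA -/v k'E; exact: col.
(* Pairing with basis vectors shows [k'] times each conjugate coordinate of [v] to be integral;
   conjugating, primitivity of [v] applies. *)
have ek' : eis (Num.conj k').
  apply: prim => i; rewrite mxE; apply/eis_conj; rewrite rmorphM /= conjCK.
  move: i; apply: ord3P.
  - by have := ek _ (eisv_delta 2); rewrite hermE !mxE /= !mul0r !add0r mul1r.
  - by have := ek _ (eisv_delta 1); rewrite hermE !mxE /= !mul0r add0r addr0 mul1r.
  - by have := ek _ (eisv_delta 0); rewrite hermE !mxE /= !mul0r !addr0 mul1r.
have k'0 : k' != 0 by rewrite mulf_neq0 ?invr_eq0.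
have hk' : k' * herm v v = k * herm w w.
  by rewrite {1}/v hermZl mulrCA mulrC k'E.
have le4 : nsq k' * hsq v ^+ 2 <= 4.
  rewrite -nsq_real -nsqM -hsqE hk'; have := nsq_sub_le (mu + k * herm w w) mu.
  by rewrite addrAC subrr add0r mu1 nu1; lra.
have ge1 : 1 <= nsq k' by rewrite -nsqJ nsq_ge1 ?conjC_eq0.
have v0 : 0 < hsq v by rewrite hsqZ mulr_gt0 -?herm_gt0 // lt0r nsq_eq0 f0 nsq_ge0.
have [n hn] := herm_self_int hc.
have n0 : 0 < n by rewrite -(ltr0z R) -hn.
have n2 : n ^+ 2 <= 4.
  rewrite -(ler_int R) rmorphXn /= -hn; nra.
have : n = 1 \/ n = 2 by move: n n0 n2 {hn}; exact: int_sqr_le4.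
by rewrite hn; case=> ->; [left|right].
Qed.

End Integrality.

(** * Descent in the orbit of a polar vector *)

Section Orbits.
Variable R : realType.
Local Notation C := R[i].
Implicit Types (u v w : 'cV[C]_3).

Lemma J_involutive : J R *m J R = 1%:M.
Proof.
by apply/matrixP; apply: ord3P; apply: ord3P;
  rewrite mxE sum3 !mxE /= ?(mul0r, mulr0, mulr1, addr0, add0r).
Qed.

Lemma mx_integralM (A B : 'M[C]_3) :
  mx_integral 3 A -> mx_integral 3 B -> mx_integral 3 (A *m B).
Proof.
move=> /mx_integralP hA /mx_integralP hB; apply/mx_integralP => i j.
by rewrite mxE sum3; do !apply: eisD; apply: eisM.
Qed.

Lemma mx_integralJ : mx_integral 3 (J R).
Proof. by apply/mx_integralP => i j; rewrite mxE; exact: eis_nat. Qed.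

(** The inverse of a unitary [A] is [J *m adjmx A *m J], so it inherits integrality from [A]. *)
Lemma UJ_intro (A : 'M[C]_3) : mx_integral 3 A -> adjmx A *m J R *m A = J R ->
  exists2 B : UJ R, UJ_integral 3 B & UJval B = A.
Proof.
move=> hA e; have inv : (J R *m adjmx A *m J R) *m A = 1%:M.
  by rewrite -!mulmxA (mulmxA (adjmx A)) e J_involutive.
have [_ uA] := mulmx1_unit inv.
have hU : isUJ A by rewrite /isUJ uA e eqxx.
exists (MkUJ hU) => //; split=> //=.
have -> : invmx A = J R *m adjmx A *m J R.
  by rewrite -[LHS]mul1mx -inv mulmxK.
apply: (mx_integralM _ mx_integralJ); apply: (mx_integralM mx_integralJ).
move/mx_integralP: hA => hA.
by apply/mx_integralP => i j; rewrite !mxE; apply: eisJ.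
Qed.

Lemma UJ_integralM (A B : UJ R) :
  UJ_integral 3 A -> UJ_integral 3 B -> UJ_integral 3 (A * B)%g.
Proof.
move=> [hA hA'] [hB hB']; split; first exact: mx_integralM.
have /andP[uA _] := UJvalP A; have /andP[uB _] := UJvalP B.
have -> : invmx (UJval (A * B)%g) = invmx (UJval B) *m invmx (UJval A).
  have uAB : UJval A *m UJval B \in unitmx by rewrite unitmx_mul uA.
  apply: (can_inj (mulmxK uAB)).
  by rewrite mulVmx // -mulmxA (mulmxA _ (UJval A)) mulVmx // mul1mx mulVmx.
exact: mx_integralM.
Qed.

(** Orbits of vectors under the linear group, rather than of mirrors, so that [hsq] and integrality
    of coordinates are invariants. *)
Definition same_orbit v w := exists2 B : UJ R, UJ_integral 3 B & UJval B *m v = w.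

Lemma same_orbit_trans u v w : same_orbit u v -> same_orbit v w -> same_orbit u w.
Proof.
move=> [A hA <-] [B hB <-]; exists (B * A)%g; first exact: UJ_integralM.
by rewrite mulmxA.
Qed.

Lemma same_orbit_hsq v w : same_orbit v w -> hsq w = hsq v.
Proof. by move=> [A _ <-]; rewrite /hsq herm_UJ. Qed.

Lemma same_orbit_eisv v w : same_orbit v w -> eisv v -> eisv w.
Proof. by move=> [A [hA _] <-]; exact: mulmx_integral. Qed.

Lemma vec3K v : vec3 (v 0 0) (v 1 0) (v 2 0) = v.
Proof. by apply: colP3; rewrite vec3E. Qed.

Lemma eisv_vec3 (a b c : C) : eisv (vec3 a b c) <-> [/\ eis a, eis b & eis c].
Proof.
split=> [h|[ha hb hc]]; last by apply: ord3P; rewrite vec3E.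
by split; [have := h 0|have := h 1|have := h 2]; rewrite vec3E.
Qed.

(** * Inversion and Heisenberg translations *)

Lemma same_orbit_swap (a b c : C) : same_orbit (vec3 a b c) (vec3 c b a).
Proof.
have [|B hB e] := UJ_intro mx_integralJ.
  rewrite -mulmxA J_involutive mulmx1; apply/matrixP => i j.
  by rewrite !mxE addnC rmorph_nat.
exists B => //; rewrite e.
by apply: colP3; rewrite mxE sum3 !mxE /=; ring.
Qed.

(** Heisenberg translations are unipotent isometries fixing [(1, 0, 0)]; the relation between [t]
    and [z] is the unitarity of the upper triangular matrix. *)
Lemma same_orbit_heis (z t a b c : C) : eis z -> eis t ->
  t + Num.conj t = - (z * Num.conj z) ->
  same_orbit (vec3 a b c) (vec3 (a - Num.conj z * b + t * c) (b + z * c) c).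
Proof.
move=> hz ht e.
pose A : 'M[C]_3 := \matrix_(i, j)
  (nth [::] [:: [:: 1; - Num.conj z; t]; [:: 0; 1; z]; [:: 0; 0; 1]] i)`_j.
have tJ : Num.conj t = - (z * Num.conj z) - t by rewrite -e; ring.
have [||B hB eB] := @UJ_intro A.
- apply/mx_integralP; apply: ord3P; apply: ord3P; rewrite !mxE //=;
    by [exact: (eis_nat _ 1)|exact: (eis_nat _ 0)|apply: eisN; apply: eisJ].
- apply/matrixP; apply: ord3P; apply: ord3P; rewrite !(mxE, sum3) /=;
    rewrite ?(rmorph0, rmorph1, rmorphN) /= ?conjCK ?tJ; by ring.
exists B => //; rewrite eB.
by apply: colP3; rewrite mxE sum3 !mxE /=; ring.
Qed.

Lemma vec3_hsq (a b c : C) :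
  hsq (vec3 a b c) = 2 * complex.Re (a * Num.conj c) + nsq b.
Proof.
rewrite /hsq hermE !vec3E mul_conjE; case: a b c => [a1 a2] [b1 b2] [c1 c2].
by rewrite /nsq !conjE /=; ring.
Qed.

(** Euclidean division of [b] by [c] shrinks the middle coordinate; central translations by
    multiples of [i sqrt 3] then bring the imaginary part of [a' / c] within [sqrt 3 / 2] of
    zero. *)
Lemma same_orbit_reduce (a b c : C) : eisv (vec3 a b c) -> c != 0 ->
  exists a' b', [/\ same_orbit (vec3 a b c) (vec3 a' b' c), nsq b' < nsq c
    & 4 * complex.Im (a' / c) ^+ 2 <= 3].
Proof.
move=> /eisv_vec3[ha hb hc] c0.
have [q hq qlt] := eis_round (b / c).
set z := - q; have hz : eis z by exact: eisN.
have [N hN] := nsq_nat hz.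
have hw : eis (omega R) by exact: eis_omega.
pose a1 := a - Num.conj z * b + N%:R * omega R * c.
set s : R := Num.sqrt 3; have s0 : 0 < s by rewrite sqrtr_gt0.
pose y := complex.Im (a1 / c) / s.
pose k := Num.floor (y + 2^-1).
(* [N * omega] has the required real part [- N / 2], where [N = |z|^2]; multiples of
   [1 + 2 * omega = i sqrt 3] do not alter it. *)
pose t : C := N%:R * omega R - k%:~R * (1 + 2 * omega R).
have ht : eis t.
  apply: eisB; apply: eisM => //; [exact: eis_nat|exact: eis_int|].
  by apply: eisD; [exact: eis1|apply: eisM => //; exact: eis_nat].
have tJ : t + Num.conj t = - (z * Num.conj z).
  rewrite mul_conjE hN rmorph_nat /t rmorphB !rmorphM /= rmorphD rmorphM rmorph1.
  by rewrite !rmorph_nat rmorph_int /= conj_omega; ring.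
exists (a - Num.conj z * b + t * c), (b + z * c); split.
- exact: same_orbit_heis.
- have -> : b + z * c = (b / c - q) * c by rewrite mulrBl divfK // /z mulNr.
  by rewrite nsqM gtr_pMl // lt0r nsq_eq0 c0 nsq_ge0.
- have -> : (a - Num.conj z * b + t * c) / c = a1 / c - k%:~R * (1 + 2 * omega R).
    by rewrite /a1 /t; field.
  rewrite -sqrt3_omega sqrtC3E -/s intrC.
  have -> : complex.Im (a1 / c - k%:~R%:C%C * (0 +i* s)%C) = (y - k%:~R) * s.
    have Iy : complex.Im (a1 / c) = y * s by rewrite /y divfK // gt_eqF.
    have IB (u : C) (l : R) : complex.Im (u - l%:C%C * (0 +i* s)%C) = complex.Im u - l * s.
      by case: u => p r /=; ring.
    by rewrite IB Iy mulrBl.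
  have := floor_itv (y + 2^-1); rewrite -/k intrD => /andP[y1 y2].
  have s2 : s ^+ 2 = 3 := sqr_sqrt3 R.
  rewrite exprMn s2; set e := y - _.
  have [e1 e2] : - 2^-1 <= e /\ e <= 2^-1 by rewrite /e; split; lra.
  nra.
Qed.

Lemma orbit_bottom_unit n (v : 'cV[C]_3) : n = 1 \/ n = 2 -> eisv v -> hsq v = n ->
  exists a b c, [/\ same_orbit v (vec3 a b c) & c = 0 \/
    [/\ nsq c = 1, b = 0 & 4 * complex.Im (a / c) ^+ 2 <= 3]].
Proof.
move=> n12 hv hn; have [m hm] := nsq_nat (hv 2).
elim/ltn_ind: m v hv hn hm => m IH v hv hn hm.
have [c0|c0] := eqVneq (v 2 0) 0.
  exists (v 0 0), (v 1 0), 0; split; last by left.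
  exists 1%g.
    by split; rewrite ?invmx1; apply/mx_integralP => i j; rewrite mxE; exact: eis_nat.
  by rewrite mul1mx -[LHS]vec3K c0.
move: hv hn hm c0; rewrite -[v]vec3K; move: (v 0 0) (v 1 0) (v 2 0) => a b c.
rewrite vec3E => hv hn hm c0.
have [a' [b' [o blt im]]] := same_orbit_reduce hv c0.
have hv' := same_orbit_eisv o hv; have [ha' hb' hc] := (eisv_vec3 _ _ _).1 hv'.
have := same_orbit_hsq o; rewrite hn vec3_hsq => e.
have mpos : (0 < m)%N by rewrite lt0n -(pnatr_eq0 R) -hm nsq_eq0.
have m2 : m <> 2 by move=> h; apply: (nsq_neq2 hc); rewrite hm h.
set r := a' / c in im; have a'E : a' = r * c by rewrite divfK.
have re : complex.Re (a' * Num.conj c) = complex.Re r * nsq c.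
  by rewrite a'E -mulrA mul_conjE; case: r {im a'E} => p q /=; ring.
have [m1|m3] : m = 1%N \/ (3 <= m)%N by lia.
  exists a', b', c; split=> //; right; split=> //; first by rewrite hm m1.
  have [k hk] := nsq_nat hb'; apply/eqP; rewrite -nsq_eq0 hk.
  by move: blt; rewrite hk hm m1 ltr_nat ltnS leqn0 pnatr_eq0.
have [k hk] := nsq_nat ha'.
(* As [|b'|^2 < m] and [n <= 2 < m], the norm equation puts the real part of [a' / c] strictly
   between -1/2 and 1/2; with the bound [sqrt 3 / 2] on the imaginary part, [|a' / c| < 1]. *)
have km : (k < m)%N.
  rewrite -(ltr_nat R) -hk -hm a'E nsqM.
  rewrite gtr_pMl; last by rewrite hm ltr0n.
  rewrite /nsq; have b0 := nsq_ge0 b'; rewrite re hm in e.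
  have M3 : 3 <= m%:R :> R by rewrite ler_nat.
  rewrite hm in blt; set x := complex.Re r in e *.
  have x1 : -1 < 2 * x by case: n12 => n12; nra.
  have x2 : 2 * x < 1 by case: n12 => n12; nra.
  nra.
have o' : same_orbit (vec3 a b c) (vec3 c b' a').
  exact: same_orbit_trans o (same_orbit_swap _ _ _).
have [|||p [q [l [o'' h]]]] := IH k km (vec3 c b' a').
- exact: same_orbit_eisv o' hv.
- by rewrite (same_orbit_hsq o').
- by rewrite vec3E.
by exists p, q, l; split=> //; exact: same_orbit_trans o' o''.
Qed.

Lemma orbit_norm1_cusp (a b : C) : eisv (vec3 a b 0) -> nsq b = 1 ->
  exists2 c, c != 0 & same_orbit (vec3 a b 0) (c *: w1 R).
Proof.
move=> /eisv_vec3[ha hb _] b1; have bJ : b * Num.conj b = 1 by rewrite mul_conjE b1.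
exists b; first by rewrite -nsq_eq0 b1 oner_neq0.
(* Since [b] is a unit, [conj z * b = a], so the translation kills the first coordinate. *)
pose z := Num.conj a * b; have hz : eis z by apply: eisM => //; exact: eisJ.
have [N hN] := nsq_nat hz.
have := @same_orbit_heis z (N%:R * omega R) a b 0 hz.
have -> : vec3 (a - Num.conj z * b + N%:R * omega R * 0) (b + z * 0) 0 = b *: w1 R.
  apply: colP3; rewrite vec3E mxE vec3E ?mulr0 ?mulr1 ?addr0 //.
  by rewrite rmorphM /= conjCK -mulrA (mulrC _ b) bJ mulr1 subrr.
apply; first by apply: eisM; [exact: eis_nat|exact: eis_omega].
by rewrite mul_conjE hN rmorphM !rmorph_nat /= conj_omega; ring.
Qed.

Lemma eis_re_im (u : C) (n : int) : eis u -> 2 * complex.Re u = n%:~R ->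
  4 * complex.Im u ^+ 2 <= 3 -> exists x y : int,
  [/\ u = x%:~R + y%:~R * omega R, n = 2 * x - y & `|y| <= 1].
Proof.
move=> [x [y ->]] h1 h2; exists x, y; split=> //; move: h1 h2;
  rewrite !intrC /= => h1 h2; have s2 := sqr_sqrt3 R.
  by apply: (@intr_inj R); rewrite intrB intrM -h1; lra.
have : y ^+ 2 <= 1 by rewrite -(ler_int R) rmorphXn /=; nra.
nia.
Qed.

Lemma orbit_norm1 v : eisv v -> hsq v = 1 ->
  exists2 c, c != 0 & same_orbit v (c *: w1 R).
Proof.
move=> hv hn; have [|a [b [c [o h]]]] := orbit_bottom_unit _ hv hn; first by left.
have hv' := same_orbit_eisv o hv; have [ha hb hc] := (eisv_vec3 _ _ _).1 hv'.
have := same_orbit_hsq o; rewrite hn vec3_hsq => e.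
case: h => [c0|[c1 b0 im]].
  rewrite c0 rmorph0 mulr0 mulr0 add0r in e o hv'.
  by have [d d0 o'] := orbit_norm1_cusp hv' e; exists d => //; exact: same_orbit_trans o o'.
have cJ : c * Num.conj c = 1 by rewrite mul_conjE c1.
have c0 : c != 0 by rewrite -nsq_eq0 c1 oner_neq0.
have rE : a / c = a * Num.conj c by rewrite -[Num.conj c](mulKf c0) cJ mulr1.
have hr : eis (a / c) by rewrite rE; apply: eisM => //; exact: eisJ.
set r := a / c in im hr rE.
have re : r + Num.conj r = 1.
  move: e; rewrite b0 -rE; case: r {im hr rE} => p q; rewrite /nsq conjE /= => e.
  by apply/eqP; rewrite eq_complex /=; apply/andP; split; apply/eqP; lra.
(* Twice the real part of [r] is [1 = |z|^2] for [z = 1], so [t = - r] is admissible and kills the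
   first coordinate; swapping then leads back to a zero last coordinate. *)
have o1 : same_orbit v (vec3 0 c c).
  apply: same_orbit_trans o _.
  have := @same_orbit_heis 1 (- r) a b c (eis1 _) (eisN hr).
  have -> : a - Num.conj 1 * b + - r * c = 0.
    by rewrite b0 mulr0 subr0 mulNr divfK // subrr.
  rewrite b0 (mul1r c) add0r; apply.
  by rewrite rmorphN -opprD re rmorph1 mulr1.
have o2 := same_orbit_trans o1 (same_orbit_swap _ _ _).
have [d d0 o'] := orbit_norm1_cusp (same_orbit_eisv o2 hv) c1.
by exists d => //; exact: same_orbit_trans o2 o'.
Qed.

(** A zero last coordinate would make [b] an Eisenstein integer of norm 2. Otherwise [a / c] has
    trace 2 and small imaginary part, which forces it to be 1. *)
Lemma orbit_norm2 v : eisv v -> hsq v = 2 ->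
  exists2 c, c != 0 & same_orbit v (c *: w2 R).
Proof.
move=> hv hn; have [|a [b [c [o h]]]] := orbit_bottom_unit _ hv hn; first by right.
have hv' := same_orbit_eisv o hv; have [ha hb hc] := (eisv_vec3 _ _ _).1 hv'.
have := same_orbit_hsq o; rewrite hn vec3_hsq => e.
case: h => [c0|[c1 b0 im]].
  by rewrite c0 rmorph0 mulr0 mulr0 add0r in e; case: (nsq_neq2 hb).
have cJ : c * Num.conj c = 1 by rewrite mul_conjE c1.
have c0 : c != 0 by rewrite -nsq_eq0 c1 oner_neq0.
have rE : a / c = a * Num.conj c by rewrite -[Num.conj c](mulKf c0) cJ mulr1.
have hr : eis (a / c) by rewrite rE; apply: eisM => //; exact: eisJ.
have [|x [y [ry nxy y1]]] := @eis_re_im (a / c) 2 hr _ im.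
  by move: e; rewrite b0 rE /nsq /= expr0n !addr0.
exists c => //; suff -> : c *: w2 R = vec3 a b c by [].
(* [2 = 2 * x - y] makes [y] even, hence zero as [|y| <= 1]. *)
have [y0 x1] : y = 0 /\ x = 1 by lia.
have ac : a / c = 1 by rewrite ry y0 x1 mul0r addr0.
have ac' : a = c by rewrite -(divfK c0 a) ac mul1r.
by apply: colP3; rewrite mxE !vec3E ?mulr1 ?mulr0.
Qed.

End Orbits.

(** * Disjointness and stabilizers *)

Section Stabilizers.
Variable R : realType.
Local Notation C := R[i].
Implicit Types (u v w : 'cV[C]_3).

Lemma mirrorZ c w : c != 0 -> mirror (c *: w) = mirror w.
Proof.
move=> c0; rewrite /mirror; congr (_ `&` _)%classic.
apply/seteqP; split=> L h v vL; last by rewrite hermZr h ?mulr0.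
have /eqP := h v vL; rewrite hermZr mulf_eq0 conjC_eq0 (negPf c0) /=.
by move/eqP.
Qed.

Lemma mirror_image (B : UJ R) v :
  (PU_act (\pi_(PU R)%qT B) @` mirror v)%classic = mirror (UJval B *m v).
Proof.
apply/seteqP; split=> L.
  case=> _ /mirrorP[u [u0 uv ->]] <-; rewrite PU_actE UJ_act_line.
  by apply: mirror_line; rewrite herm_UJ.
case/mirrorP => u [u0 uv ->]; have /andP[uB _] := UJvalP B.
have e : UJval B *m (invmx (UJval B) *m u) = u by rewrite mulmxA mulmxV ?mul1mx.
exists <[invmx (UJval B) *m u]>%VS; last by rewrite PU_actE UJ_act_line e.
by apply: mirror_line; rewrite -(herm_UJ B) e.
Qed.

Lemma UJ_integralV (A : UJ R) : UJ_integral 3 A -> UJ_integral 3 (A^-1)%g.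
Proof. by move=> [hA hA']; split=> //=; rewrite invmxK. Qed.

Lemma in_PU_orbit_same_orbit v w c :
  c != 0 -> same_orbit v (c *: w) -> in_PU_orbit (Gamma R 3) (mirror v) (mirror w).
Proof.
move=> c0 [B hB e]; exists (\pi_(PU R)%qT (B^-1)%g); split.
  by exists (B^-1)%g => //; exact: UJ_integralV.
have /andP[uB _] := UJvalP B.
rewrite -(mirrorZ w c0) mirror_image -e /= mulmxA mulVmx ?mul1mx //.
Qed.

(** * The two orbits are distinct *)

Lemma eisv_w1 : eisv (w1 R).
Proof. by apply/eisv_vec3; split; [exact: eis0|exact: eis1|exact: eis0]. Qed.

Lemma eisv_w2 : eisv (w2 R).
Proof. by apply/eisv_vec3; split; [exact: eis1|exact: eis0|exact: eis1]. Qed.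

Lemma hsq_w1 : hsq (w1 R) = 1.
Proof. by rewrite vec3_hsq rmorph0 mulr0 /nsq /=; ring. Qed.

Lemma hsq_w2 : hsq (w2 R) = 2.
Proof. by rewrite vec3_hsq rmorph1 mulr1 /nsq /=; ring. Qed.

(** Equal mirrors have proportional polar vectors [A w1] and [B w2]. Comparing norms, the factor [c]
    has norm 2, while pulling back by [A] shows that [c] is an Eisenstein integer. *)
Lemma orbits_w1_w2_disjoint (M : set {vspace 'cV[C]_3}) :
  in_PU_orbit (Gamma R 3) M (mirror (w1 R)) ->
  ~ in_PU_orbit (Gamma R 3) M (mirror (w2 R)).
Proof.
move=> [_ [[A hA <-] ->]] [_ [[B hB <-]]]; rewrite !mirror_image => e.
have [||c hc] := @mirror_sub_collinear _ (UJval A *m w1 R) (UJval B *m w2 R).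
- by rewrite herm_UJ herm_gt0 hsq_w1.
- by rewrite e.
have c2 : nsq c = 2.
  have : hsq (UJval B *m w2 R) = 2 by rewrite /hsq herm_UJ -/(hsq _) hsq_w2.
  by rewrite hc hsqZ /hsq herm_UJ -/(hsq _) hsq_w1 mulr1.
have /andP[uA _] := UJvalP A.
have cw : c *: w1 R = invmx (UJval A) *m (UJval B *m w2 R).
  by rewrite hc -scalemxAr mulmxA mulVmx ?mul1mx.
have : eisv (c *: w1 R).
  rewrite cw; apply: mulmx_integral; first exact: hA.2.
  by apply: mulmx_integral; [exact: hB.1|exact: eisv_w2].
by move/(_ 1); rewrite mxE vec3E mulr1 => /nsq_neq2; apply.
Qed.

(** * Cyclic stabilizers *)

Lemma cyclic_of_orderI (S : set (PU R)) (g : PU R) n : (0 < n)%N ->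
  (g ^+ n)%g = 1%g -> (forall k, (0 < k < n)%N -> (g ^+ k)%g <> 1%g) ->
  (forall h, S h <-> exists2 k, (k < n)%N & h = (g ^+ k)%g) -> cyclic_of_order S n.
Proof.
move=> n0 gn gk hS.
have gmod k : (g ^+ k = g ^+ (k %% n))%g.
  by rewrite {1}(divn_eq k n) expgnDr mulnC expgnA gn expg1n mul1g.
split.
  exists g; apply/seteqP; split=> h; rewrite /= hS.
    by case=> k _ ->; exists k; left.
  case=> k [->|->]; first by exists (k %% n)%N; rewrite ?ltn_mod.
  (* The outer reduction covers [k] divisible by [n], where [n - k %% n] is [n] itself. *)
  exists ((n - k %% n) %% n)%N; first by rewrite ltn_mod.
  rewrite -gmod (gmod k); apply: (mulIg (g ^+ (k %% n))%g).
  by rewrite mulVg -expgnDr subnK ?gn // ltnW // ltn_mod.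
have -> : S = ((fun k => (g ^+ k)%g) @` `I_n)%classic.
  apply/seteqP; split=> h; rewrite hS.
    by case=> k kn ->; exists k.
  by case=> k kn <-; exists k.
apply: inj_card_eq => i j; rewrite !inE /= => i_n j_n.
wlog ij : i j i_n j_n / (i <= j)%N.
  by move=> H; case/orP: (leq_total i j) => h e; [exact: H|apply/esym/H].
move=> e; apply/eqP; rewrite eqn_leq ij leqNgt /=; apply/negP => lt.
apply: (gk (j - i)%N); first by rewrite subn_gt0 lt (leq_ltn_trans (leq_subr _ _)).
by rewrite expgnFr // e mulgV.
Qed.

Lemma entry_mul_delta (A : 'M[C]_3) i j : A i j = (A *m (delta_mx j 0 : 'cV_3)) i 0.
Proof. by rewrite -colE mxE. Qed.

(** Gram matrix of the columns; the indices are exchanged because [herm] is conjugate-linear in its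
    second argument. *)
Lemma adjmx_mul_entry (A : 'M[C]_3) i j :
  (adjmx A *m J R *m A) i j = herm (A *m delta_mx j 0) (A *m delta_mx i 0).
Proof.
rewrite -!colE /herm !mxE; apply: eq_bigr => k _; rewrite !mxE.
by congr (_ * _); apply: eq_bigr => l _; rewrite !mxE.
Qed.

(** The equation on [k] is unitarity: [<Bx, By> - <x, y>] is its left-hand side times
    [<x, w> conj <y, w>]. *)
Lemma reflection_intro w k : eisv w -> eis k ->
  k + Num.conj k + k * Num.conj k * herm w w = 0 ->
  exists2 B : UJ R, UJ_integral 3 B &
    forall x, UJval B *m x = x + (k * herm x w) *: w.
Proof.
move=> hw hk hk0; pose A : 'M[C]_3 := 1%:M + k *: (w *m (adjmx w *m J R)).
have AE x : A *m x = x + (k * herm x w) *: w.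
  rewrite mulmxDl mul1mx -scalemxAl -mulmxA [_ *m x]mx11_scalar -/(herm x w).
  by rewrite mul_mx_scalar scalerA.
have [||B hB eB] := @UJ_intro _ A.
- apply/mx_integralP => i j.
  rewrite entry_mul_delta AE !mxE; apply: eisD; first exact: eis_nat.
  by apply: eisM => //; apply: eisM => //; apply: eis_herm => //; exact: eisv_delta.
- apply/matrixP => i j; rewrite adjmx_mul_entry.
  have -> : J R i j = herm (delta_mx j 0) (delta_mx i 0).
    by have := adjmx_mul_entry 1%:M i j; rewrite adjmx1 mul1mx mulmx1 !mul1mx.
  move: (delta_mx j 0) (delta_mx i 0) => x y.
  rewrite !AE !(hermDl, hermDr, hermZl, hermZr) rmorphM /= (herm_conj w y).
  apply/eqP; rewrite -subr_eq0; apply/eqP.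
  transitivity ((k + Num.conj k + k * Num.conj k * herm w w)
    * (herm x w * Num.conj (herm y w))); first by ring.
  by rewrite hk0 mul0r.
by exists B => // x; rewrite eB.
Qed.

Lemma pi_PU_exp (B : UJ R) k : (\pi_(PU R)%qT B ^+ k)%g = \pi_(PU R)%qT (B ^+ k)%g.
Proof. by elim: k => [|k IH] //; rewrite !expgS IH [RHS]pi_PU_mul. Qed.

Lemma Gamma_pi (A : UJ R) : UJ_integral 3 A -> Gamma R 3 (\pi_(PU R)%qT A).
Proof. by exists A. Qed.

(* The reflections [x -> x + (z ^+ j - 1) / <w, w> <x, w> w] are the powers of the one
   with multiplier [z]. *)
Lemma stabilizer_cyclic w (z : C) n : eisv w -> 0 < herm w w ->
  eis ((z - 1) / herm w w) -> nsq z = 1 -> (0 < n)%N -> z ^+ n = 1 ->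
  (forall j, (0 < j < n)%N -> z ^+ j != 1) ->
  (forall A mu k, UJ_integral 3 A -> nsq mu = 1 -> nsq (mu + k * herm w w) = 1 ->
     (forall x, UJval A *m x = mu *: x + (k * herm x w) *: w) ->
     exists2 j, (j < n)%N & mu + k * herm w w = mu * z ^+ j) ->
  cyclic_of_order (pointwise_stabilizer (Gamma R 3) (mirror w)) n.
Proof.
move=> hw w0 ek z1 n0 zn zj H; have wn0 : herm w w != 0 by rewrite gt_eqF.
have hJ : Num.conj (herm w w) = herm w w by rewrite -herm_conj.
set k := (z - 1) / herm w w in ek.
have zJ : z * Num.conj z = 1 by rewrite mul_conjE z1.
have [|B hB eB] := reflection_intro hw ek.
  (* For this [k] the unitarity equation reads [(|z|^2 - 1) / herm w w = 0]. *)
  rewrite /k rmorphM fmorphV rmorphB rmorph1 /= hJ.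
  rewrite (_ : _ + _ = (z * Num.conj z - 1) / herm w w); last by field.
  by rewrite zJ subrr mul0r.
have eBj j x : UJval (B ^+ j)%g *m x = x + ((z ^+ j - 1) / herm w w * herm x w) *: w.
  elim: j x => [|j IH] x.
    by rewrite expg0 expr0 subrr mul0r mul0r scale0r addr0 mul1mx.
  rewrite expgS /= -mulmxA IH eB hermDl hermZl -addrA -scalerDl; congr (_ + _ *: _).
  by rewrite /k exprS; field.
have fixB : fixes_pointwise (\pi_(PU R)%qT B) (mirror w).
  move=> _ /mirrorP[v [v0 vw ->]]; rewrite PU_actE UJ_act_line eB vw mulr0 scale0r.
  by rewrite addr0.
have fixBj j : fixes_pointwise (\pi_(PU R)%qT (B ^+ j)%g) (mirror w).
  move=> _ /mirrorP[v [v0 vw ->]]; rewrite PU_actE UJ_act_line eBj vw mulr0 scale0r.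
  by rewrite addr0.
have intBj j : UJ_integral 3 (B ^+ j)%g.
  elim: j => [|j IH]; last by rewrite expgS; exact: UJ_integralM.
  by split; rewrite /= ?invmx1; apply/mx_integralP => a b; rewrite mxE; exact: eis_nat.
have [v0 hv0 v0w] := neg_perp w0.
have v0n0 : v0 != 0 by apply: contraTneq hv0 => ->; rewrite herm0r ltxx.
have wv0 : w != 0 by apply: contraTneq w0 => ->; rewrite herm0r ltxx.
apply: (@cyclic_of_orderI _ (\pi_(PU R)%qT B)) => //.
- rewrite pi_PU_exp; apply/(PU_eqP _ 1%g); exists 1; rewrite scale1r.
  apply/matrixP => i j; have /colP/(_ i) := eBj n (delta_mx j 0).
  by rewrite zn subrr !mul0r scale0r addr0 -colE !mxE eqxx andbT.
- move=> j jn; rewrite pi_PU_exp => /(PU_eqP _ 1%g)[c ec].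
  (* Triviality in [PU R] only makes the power a scalar [c]; the vector [v0], orthogonal to [w],
     gives [c = 1], and then [w] gives [z ^+ j = 1]. *)
  have ex x : UJval (B ^+ j)%g *m x = c *: x by rewrite ec -scalemxAl mul1mx.
  have := eBj j v0; rewrite ex v0w mulr0 scale0r addr0 -[RHS]scale1r => /eqP.
  rewrite -subr_eq0 -scalerBl scaler_eq0 (negPf v0n0) orbF subr_eq0 => /eqP c1.
  have := eBj j w; rewrite ex c1 scale1r divfK // => /eqP.
  rewrite eq_sym addrC -subr_eq0 addrK scaler_eq0 (negPf wv0) orbF subr_eq0.
  by apply/negP; exact: zj.
- move=> h; split; last by case=> j _ ->; rewrite pi_PU_exp; split => //; exact: Gamma_pi.
  case=> [[A hA <-]] fixA; have [mu [l [e mu1 nu1]]] := reflection_form w0 fixA.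
  have [j jn hj] := H A mu l hA mu1 nu1 e; exists j => //.
  (* [A] and [B ^+ j] differ by the scalar [mu], invisible in [PU R]. *)
  rewrite pi_PU_exp; apply/PU_eqP; exists mu; apply/matrixP => a b.
  rewrite !entry_mul_delta -scalemxAl eBj e scalerDr scalerA; congr ((_ + _ *: _ : 'cV[C]_3) a 0).
  have -> : l = (mu * z ^+ j - mu) / herm w w by rewrite -hj; field.
  by field.
Qed.

(** [mu] and [mu + k] are diagonal entries of [A] of modulus one, so their ratio is one of the six
    units. *)
Lemma stabilizer_w1 :
  cyclic_of_order (pointwise_stabilizer (Gamma R 3) (mirror (w1 R))) 6.
Proof.
have hw : herm (w1 R) (w1 R) = 1 by rewrite hsqE hsq_w1.
have ez : eis (1 + omega R) by apply: eisD; [exact: eis1|exact: eis_omega].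
have o2 := omega_sqr R.
apply: (@stabilizer_cyclic _ (1 + omega R)) => //.
- exact: eisv_w1.
- by rewrite hw.
- by rewrite hw divr1; apply: eisB => //; exact: eis1.
- by have := nsq_intr R 1 1; rewrite !mul1r.
- by ring: o2.
- exact: omega_pow_neq1.
move=> A mu k hA mu1 nu1 e; rewrite hw mulr1 in nu1 *.
have e0 : eis mu.
  have := mulmx_integral hA.1 (eisv_delta R 0) 0.
  by rewrite e hermE !mxE /= !(rmorph0, rmorph1, mulr0, mul0r, mulr1, addr0).
have e1 : eis (mu + k).
  have := mulmx_integral hA.1 (eisv_delta R 1) 1.
  by rewrite e hermE !mxE /= !(rmorph0, rmorph1, mulr0, mul0r, mulr1, addr0, add0r).
have muJ : mu * Num.conj mu = 1 by rewrite mul_conjE mu1.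
have [|j jn hj] := eis_unit_pow (eisM e1 (eisJ e0)).
  by rewrite nsqM nsqJ mu1 nu1 mulr1.
by exists j => //; rewrite -hj mulrCA muJ mulr1.
Qed.

(** Here [k] is an off-diagonal entry of [A], and the parallelogram identity for [mu] and
    [mu + k * 2] bounds its norm by 1. Norm 0 makes [A] scalar; norm 1 makes the two eigenvalues
    opposite. *)
Lemma stabilizer_w2 :
  cyclic_of_order (pointwise_stabilizer (Gamma R 3) (mirror (w2 R))) 2.
Proof.
have hw : herm (w2 R) (w2 R) = 2 by rewrite hsqE hsq_w2 rmorph_nat.
apply: (@stabilizer_cyclic _ (-1)) => //.
- exact: eisv_w2.
- by rewrite hw.
- have -> : (-1 - 1) / herm (w2 R) (w2 R) = -1 by rewrite hw; field.
  exact/eisN/eis1.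
- by rewrite /nsq /=; ring.
- by ring.
- move=> [|[|j]] // _; rewrite expr1 -subr_eq0 -opprD oppr_eq0.
  by rewrite -[1 + 1]/(2%:R) pnatr_eq0.
move=> A mu k hA mu1 nu1 e; rewrite hw in nu1 *.
have ek : eis k.
  have := mulmx_integral hA.1 (eisv_delta R 0) 2.
  by rewrite e hermE !mxE /= !(rmorph0, rmorph1, mulr0, mul0r, mulr1, addr0, add0r).
have [m hm] := nsq_nat ek.
have par : 4 * nsq k + nsq (mu + k * 2 + mu) = 4.
  transitivity (2 * nsq (mu + k * 2) + 2 * nsq mu); last by rewrite mu1 nu1; ring.
  by case: mu k {e mu1 nu1 hm ek} => [a b] [c d]; rewrite /nsq /=; ring.
have := nsq_ge0 (mu + k * 2 + mu); rewrite hm in par => p0.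
have m1 : (m <= 1)%N by rewrite -(ler_nat R); lra.
case: m m1 hm par => [|[|//]] _ hm par.
- exists 0%N => //; move/eqP: hm; rewrite nsq_eq0 => /eqP ->.
  by rewrite mul0r addr0 expr0 mulr1.
- exists 1%N => //; have /eqP : nsq (mu + k * 2 + mu) = 0 by lra.
  by rewrite nsq_eq0 addr_eq0 => /eqP ->; rewrite expr1 mulrN1.
Qed.

End Stabilizers.

Theorem mainTheorem9 (R : realType) :
  (forall (g : PU R) (w : 'cV[R[i]]_3),
     Gamma R 3 g -> complex_reflection_in g w ->
     (in_PU_orbit (Gamma R 3) (mirror w) (mirror (w1 R)) /\
        ~ in_PU_orbit (Gamma R 3) (mirror w) (mirror (w2 R)))
     \/ (in_PU_orbit (Gamma R 3) (mirror w) (mirror (w2 R)) /\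
        ~ in_PU_orbit (Gamma R 3) (mirror w) (mirror (w1 R))))
  /\ cyclic_of_order (pointwise_stabilizer (Gamma R 3) (mirror (w1 R))) 6
  /\ cyclic_of_order (pointwise_stabilizer (Gamma R 3) (mirror (w2 R))) 2.
Proof.
split; last by split; [exact: stabilizer_w1|exact: stabilizer_w2].
move=> _ w [A [hA _] <-] [ne1 _ w0 fixA].
have [c [c0 hc n12]] := reflection_primitive hA w0 fixA ne1.
rewrite -(mirrorZ w c0); case: n12 => hn.
- left; have [d d0 o] := orbit_norm1 hc hn.
  have o1 := in_PU_orbit_same_orbit d0 o.
  by split; [exact: o1|exact: orbits_w1_w2_disjoint o1].
- right; have [d d0 o] := orbit_norm2 hc hn.
  have o2 := in_PU_orbit_same_orbit d0 o.
  by split; [exact: o2|move=> o1; exact: orbits_w1_w2_disjoint o1 o2].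
Qed.
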